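(* Fix positive integers $r$, $k$, and $n$. Then there exist algorithmically computable compositions $\mathbf{s}_1,\ldots,\mathbf{s}_m$, coefficients $c_1,\ldots,c_m\in\mathbb{Q}$, and exponents $b_1,\ldots,b_m\in\mathbb{Z}$, all independent of $p$, such that \[ C_{r,k,p}\equiv\sum_{i=1}^m c_ip^{b_i}H_{p-1}(\mathbf{s}_i)\pmod{p^n} \] holds for all sufficiently large primes $p$.
   Context: A composition is a finite ordered list $\mathbf{s}=(s_1,\ldots,s_j)$ of positive integers, and $H_N(\mathbf{s})=\sum_{N\geq n_1>\cdots>n_j\geq1}\frac{1}{n_1^{s_1}\cdots n_j^{s_j}}$. For positive integers $r,k$ and a prime $p$, $C_{r,k,p}:=\sum\frac{1}{n_1\cdots n_k}$, the sum over $k$-tuples of positive integers with $n_1+\cdots+n_k=p^r$ and $p\nmid n_1\cdots n_k$. For rationals $x,y$, $x\equiv y\pmod{p^n}$ means the numerator of $x-y$ is divisible by $p^n$. *)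

(* Defs.v *)
From HB Require Import structures.
From mathcomp Require Import all_boot all_order all_algebra.

Set Implicit Arguments.
Unset Strict Implicit.
Unset Printing Implicit Defensive.

Import GRing.Theory Num.Theory.
Local Open Scope ring_scope.

Definition is_composition (s : seq nat) : bool := all (leq 1) s.

(* H_N(s); for the empty composition this is the empty product, 1. *)
Definition mhs (N : nat) (s : seq nat) : rat :=
  \sum_(n : {ffun 'I_(size s) -> 'I_N.+1}
         | [forall i, (0 < n i)%N]
           && [forall i : 'I_(size s), forall j : 'I_(size s),
                 (i < j)%N ==> (n j < n i)%N])
     \prod_(i < size s) ((n i)%:R ^+ nth 0%N s i)^-1.

(* C_{r,k,p}; bounding every n_i by p ^ r loses nothing, as the n_i sum to
   p ^ r. *)
Definition Csum (r k p : nat) : rat :=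
  \sum_(n : {ffun 'I_k -> 'I_(p ^ r).+1}
         | [&& [forall i, (0 < n i)%N],
               (\sum_(i < k) n i)%N == (p ^ r)%N
             & ~~ (p %| \prod_(i < k) n i)%N])
     (\prod_(i < k) (n i)%:R)^-1.

Definition rat_congr (M : nat) (x y : rat) : Prop := (M %| numq (x - y))%Z.

(* Kleene's general recursive functions: the least class of total functions
   nat^m -> nat containing zero, successor and the projections and closed under
   composition, primitive recursion and minimisation of regular functions. *)
Inductive recursive : forall m : nat, (m.-tuple nat -> nat) -> Prop :=
| rec_zero m : @recursive m (fun _ => 0%N)
| rec_succ : @recursive 1 (fun v => (thead v).+1)
| rec_proj m (i : 'I_m) : recursive (fun v => tnth v i)
| rec_comp m l (f : l.-tuple nat -> nat) (g : 'I_l -> m.-tuple nat -> nat) :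
    recursive f -> (forall i, recursive (g i)) ->
    recursive (fun v => f [tuple g i v | i < l])
| rec_primrec m (f : m.-tuple nat -> nat) (g : m.+2.-tuple nat -> nat)
    (h : m.+1.-tuple nat -> nat) :
    recursive f -> recursive g ->
    (forall v : m.-tuple nat, h (cons_tuple 0%N v) = f v) ->
    (forall (x : nat) (v : m.-tuple nat),
       h (cons_tuple x.+1 v)
       = g (cons_tuple x (cons_tuple (h (cons_tuple x v)) v))) ->
    recursive h
| rec_min m (f : m.+1.-tuple nat -> nat) (h : m.-tuple nat -> nat) :
    recursive f ->
    (forall v : m.-tuple nat, f (cons_tuple (h v) v) = 0%N) ->
    (forall (v : m.-tuple nat) (y : nat),
       (y < h v)%N -> f (cons_tuple y v) <> 0%N) ->
    recursive h
| rec_ext m (f h : m.-tuple nat -> nat) :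
    f =1 h -> recursive f -> recursive h.

(* Computability relative to the Goedel numberings given by [pickle], which on
   the types built from nat, int, rat, pairs and sequences are the explicit
   effective codings of the library. It is not meant for a countType whose
   [pickle] is abstract. *)
Definition computable (A B : countType) (f : A -> B) : Prop :=
  exists2 g : 1.-tuple nat -> nat,
    recursive g & forall a : A, g [tuple pickle a] = pickle (f a).

(* The term (s, c, b) stands for c * p ^ b * H_{p-1}(s). *)
Definition mhs_term : countType := (seq nat * rat * int)%type.

Definition term_comp (t : mhs_term) : seq nat := t.1.1.
Definition term_coef (t : mhs_term) : rat := t.1.2.
Definition term_expo (t : mhs_term) : int := t.2.

Definition eval_terms (p : nat) (L : seq mhs_term) : rat :=
  \sum_(t <- L) term_coef t * p%:R ^ term_expo t * mhs p.-1 (term_comp t).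

(* Main.v *)
Require Import Defs.
From HB Require Import structures.
From mathcomp Require Import all_boot all_order all_algebra.
From mathcomp Require Import zify ring.

(** Let P = p ^ (r - 1) and write x^(M) for the coefficient of y ^ M in
    (1 - y) ^ (- x), that is x (x + 1) ... (x + M - 1) / M!. The generating
    series of the numbers C_{r,k,p} t ^ k / k! over k is the coefficient of
    y ^ (p ^ r) in (1 - y ^ p) ^ (t / p) (1 - y) ^ (- t). Splitting off the
    multiples of p in t^(pN) gives t^(pN) = (t/p)^(N) W_N(t), where W_N(t) is
    the product of the 1 + t / n over n < pN prime to p; hence this coefficient
    is the sum over N <= P of (t/p)^(N) (- t/p)^(P - N) W_N(t).

    Truncating the p-adic expansion of each 1 / (a + p j) after E = n + k r
    terms changes the coefficient of t ^ k by a multiple of p ^ n, and makes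
    each coefficient of W_N a polynomial in N. After Newton interpolation in N
    the sum over N is evaluated by Vandermonde's identity, which leaves
    binomial coefficients binom(P - 1, c - 1), polynomial in P. Finally W_i is
    a product over 0 < a < p of polynomials in t, p and 1 / a, so expanding it
    yields the sums H_{p-1}(s) directly, without quasi-shuffle products. The
    resulting list of terms is built by loops over lists, hence computable. *)

Set Implicit Arguments.
Unset Strict Implicit.
Unset Printing Implicit Defensive.

(** * Recursive functions on natural numbers *)

(** The generating series comes from a logarithm: the sum of y ^ n / n over n prime to p is - log (1
    - y) + log (1 - y ^ p) / p, and C_{r,k,p} is the coefficient of y ^ (p ^ r) in its k-th power.
    The obstacle is that the sum over N has P + 1 terms and W_N has N (p - 1) factors, both growing
    with p, whereas the list of terms may depend on r, k and n only. What removes this dependence is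
    a bound k E, independent of p, for the degree in N of the coefficients of t ^ j in W_N with j <=
    k: only differences of W_0, ..., W_{k E} survive. The size of E comes from denominators. The
    factors of (t/p)^(N) are of the form t / (p n) and 1 + t / (p n) with n <= P, so they become
    p-integral when t is replaced by p ^ r t. On the coefficient of t ^ k this costs p ^ (k r),
    hence E = n + k r. Everything after the truncation is an equality of rational numbers.
    Computability refers to the codes of the library, so the operations on lists and rationals that
    write down the terms are shown recursive on these codes. *)

Definition rec1 (f : nat -> nat) :=
  recursive (fun v : 1.-tuple nat => f (nth 0 v 0)).
Definition rec2 (f : nat -> nat -> nat) :=
  recursive (fun v : 2.-tuple nat => f (nth 0 v 0) (nth 0 v 1)).
Definition rec3 (f : nat -> nat -> nat -> nat) :=
  recursive (fun v : 3.-tuple nat => f (nth 0 v 0) (nth 0 v 1) (nth 0 v 2)).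

Lemma rec_nth m i : i < m -> recursive (fun v : m.-tuple nat => nth 0 v i).
Proof.
move=> lt_im; apply: rec_ext (rec_proj (Ordinal lt_im)) => v.
by rewrite (tnth_nth 0).
Qed.

Lemma rec_app1 m (f : nat -> nat) (a : m.-tuple nat -> nat) :
  rec1 f -> recursive a -> recursive (fun v => f (a v)).
Proof.
move=> rf ra.
apply: rec_ext (rec_comp (g := fun _ : 'I_1 => a) rf _) => // v.
by rewrite -(tnth_nth 0 _ (Ordinal (isT : 0 < 1))) tnth_mktuple.
Qed.

Lemma rec_app2 m (f : nat -> nat -> nat) (a b : m.-tuple nat -> nat) :
  rec2 f -> recursive a -> recursive b -> recursive (fun v => f (a v) (b v)).
Proof.
move=> rf ra rb.
pose g (i : 'I_2) := if val i == 0 then a else b.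
apply: rec_ext (rec_comp (g := g) rf _) => [v|[[|[|]] ?] //].
by rewrite -!(tnth_nth 0 _ (Ordinal (isT : 0 < 2)))
           -!(tnth_nth 0 _ (Ordinal (isT : 1 < 2))) !tnth_mktuple.
Qed.

Lemma rec_app3 m (f : nat -> nat -> nat -> nat) (a b c : m.-tuple nat -> nat) :
  rec3 f -> recursive a -> recursive b -> recursive c ->
  recursive (fun v => f (a v) (b v) (c v)).
Proof.
move=> rf ra rb rc.
pose g (i : 'I_3) := if val i == 0 then a else if val i == 1 then b else c.
apply: rec_ext (rec_comp (g := g) rf _) => [v|[[|[|[|]]] ?] //].
by rewrite -!(tnth_nth 0 _ (Ordinal (isT : 0 < 3)))
           -!(tnth_nth 0 _ (Ordinal (isT : 1 < 3)))
           -!(tnth_nth 0 _ (Ordinal (isT : 2 < 3))) !tnth_mktuple.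
Qed.

Lemma rec_succS m (a : m.-tuple nat -> nat) :
  recursive a -> recursive (fun v => (a v).+1).
Proof.
by apply: (rec_app1 (f := succn)); apply: rec_ext rec_succ => v;
  rewrite /thead (tnth_nth 0).
Qed.

Lemma rec_cst m c : @recursive m (fun _ => c).
Proof. by elim: c => [|c IH]; [apply: rec_zero | apply: rec_succS]. Qed.

Lemma rec2_primrec (a : nat -> nat) (g : nat -> nat -> nat -> nat) h :
  rec1 a -> rec3 g -> (forall y, h 0 y = a y) ->
  (forall x y, h x.+1 y = g x (h x y) y) -> rec2 h.
Proof.
move=> ra rg h0 hS.
apply: (rec_primrec (m := 1) ra rg) => [v|x v] /=; first by rewrite h0.
by rewrite hS.
Qed.

Lemma rec3_primrec (a : nat -> nat -> nat) (g : nat -> nat -> nat -> nat) h :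
  rec2 a -> rec3 g -> (forall y z, h 0 y z = a y z) ->
  (forall x y z, h x.+1 y z = g (h x y z) y z) -> rec3 h.
Proof.
move=> ra rg h0 hS.
apply: (rec_primrec (m := 2)
  (g := fun v => g (nth 0 v 1) (nth 0 v 2) (nth 0 v 3)) ra).
- by apply: rec_app3 => //; apply: rec_nth.
- by move=> v; rewrite h0.
- by move=> x v; rewrite hS.
Qed.

Lemma rec1_min (f : nat -> nat -> nat) h : rec2 f ->
  (forall y, f (h y) y = 0) -> (forall y x, x < h y -> f x y <> 0) -> rec1 h.
Proof. by move=> rf h0 hS; apply: (rec_min (m := 1) rf) => [v|v x ltx] /=;
  [apply: h0|apply: hS]. Qed.

Lemma rec2_min (f : nat -> nat -> nat -> nat) h : rec3 f ->
  (forall y z, f (h y z) y z = 0) ->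
    (forall y z x, x < h y z -> f x y z <> 0) -> rec2 h.
Proof. by move=> rf h0 hS; apply: (rec_min (m := 2) rf) => [v|v x ltx] /=;
  [apply: h0|apply: hS]. Qed.

Lemma rec2_add : rec2 addn.
Proof.
apply: (rec2_primrec (a := id) (g := fun _ y _ => y.+1)) => //;
  first exact: rec_nth.
by apply: rec_succS; apply: rec_nth.
Qed.

Lemma rec1_pred : rec1 predn.
Proof.
suff r2 : rec2 (fun x _ => x.-1) by apply:
  (rec_app2 r2 (rec_nth (isT : 0 < 1)) (rec_nth (isT : 0 < 1))).
by apply: (rec2_primrec (a := fun=> 0) (g := fun x _ _ => x)) => //;
  [apply: rec_zero|apply: rec_nth].
Qed.

Lemma rec2_sub : rec2 subn.
Proof.
suff r2 : rec2 (fun x y => y - x) by apply: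
  (rec_app2 r2 (rec_nth (isT : 1 < 2)) (rec_nth (isT : 0 < 2))).
apply: (rec2_primrec (a := id) (g := fun _ y _ => y.-1)) => //.
- exact: rec_nth.
- by apply: (rec_app1 rec1_pred); apply: rec_nth.
- by move=> y; rewrite subn0.
- by move=> x y; rewrite subnS.
Qed.

Lemma rec2_mul : rec2 muln.
Proof.
apply: (rec2_primrec (a := fun=> 0) (g := fun _ y z => y + z)) => //.
- exact: rec_zero.
- by apply: (rec_app2 rec2_add); apply: rec_nth.
- by move=> x y; rewrite mulSn addnC.
Qed.

Lemma rec1_exp2 : rec1 (expn 2).
Proof.
suff r2 : rec2 (fun x _ => 2 ^ x) by apply:
  (rec_app2 r2 (rec_nth (isT : 0 < 1)) (rec_nth (isT : 0 < 1))).
apply: (rec2_primrec (a := fun=> 1) (g := fun _ y _ => y + y)) => //.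
- exact: rec_cst.
- by apply: (rec_app2 rec2_add); apply: rec_nth.
- by move=> x y; rewrite expnS mul2n addnn.
Qed.

(** The quotient is the least q with x < (q + 1) (y + 1), a condition that truncated subtraction
    turns into the vanishing of a recursive function. A successor as divisor guarantees that the
    search stops. *)
Lemma rec2_divS : rec2 (fun x y => x %/ y.+1).
Proof.
apply: (rec2_min (f := fun q x y => x.+1 - q.+1 * y.+1)).
- apply: (rec_app2 rec2_sub); first by apply: rec_succS; apply: rec_nth.
  by apply: (rec_app2 rec2_mul); apply: rec_succS; apply: rec_nth.
- by move=> y z; apply/eqP; rewrite subn_eq0 ltn_ceil.
- move=> y z x; rewrite leq_divRL // => le_q; apply/eqP.
  by rewrite subn_eq0 -ltnNge ltnS.
Qed.

Lemma subn_divn_mul m d : m - m %/ d * d = m %% d.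
Proof. by rewrite {1}(divn_eq m d) addKn. Qed.

(** The valuation is found as the least x for which 2 ^ (x + 1) leaves a nonzero remainder. The
    factor z stops the search at once for z = 0, where [logn] is 0. *)
Lemma rec1_log2 : rec1 (logn 2).
Proof.
apply: (rec1_min (f := fun x z =>
  z * (1 - (z - z %/ (2 ^ x.+1).-1.+1 * (2 ^ x.+1).-1.+1)))).
- apply: (rec_app2 rec2_mul); first exact: rec_nth.
  apply: (rec_app2 rec2_sub); first exact: rec_cst.
  have re : recursive (fun v : 2.-tuple nat => (2 ^ (nth 0 v 0).+1).-1).
    by apply/(rec_app1 rec1_pred)/(rec_app1 rec1_exp2)/rec_succS/rec_nth.
  apply: (rec_app2 rec2_sub); first exact: rec_nth.
  apply: (rec_app2 rec2_mul); last exact: rec_succS.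
  by apply: (rec_app2 rec2_divS) => //; apply: rec_nth.
- move=> [|y] //; rewrite prednK ?expn_gt0 // subn_divn_mul.
  suff : ~~ (2 ^ (logn 2 y.+1).+1 %| y.+1) by rewrite /dvdn; lia.
  by rewrite pfactor_dvdn // ltnn.
- move=> [|y] x; first by rewrite logn0.
  rewrite -(pfactor_dvdn _ (isT : prime 2)) // prednK ?expn_gt0 //
    subn_divn_mul /dvdn => /eqP -> //.
Qed.

(** * Codes of pairs, lists and numbers *)

Definition code_pair x y := CodeSeq.code [:: x; y].
Definition code_head := logn 2.
(** A list with head x and tail of code m has code 2 ^ x * (2 m + 1): the 2-adic valuation gives
    back x, and the quotient by 2 ^ (x + 1) is m. The [.-1.+1] gives the divisor the shape required
    by [rec2_divS]. *)
Definition code_tail z := z %/ (2 ^ (code_head z).+1).-1.+1.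

Lemma code_headE x m : code_head (2 ^ x * m.*2.+1) = x.
Proof.
rewrite /code_head lognM ?expn_gt0 // pfactorK // lognE /= dvdn2 /=
  odd_double /=.
by rewrite addn0.
Qed.

Lemma code_tailE x m : code_tail (2 ^ x * m.*2.+1) = m.
Proof.
rewrite /code_tail code_headE prednK ?expn_gt0 // expnSr divnMl ?expn_gt0 //.
by rewrite -muln2 -addn1 divnMDl // addn0.
Qed.

Lemma rec1_head : rec1 code_head. Proof. exact: rec1_log2. Qed.

Lemma rec1_tail : rec1 code_tail.
Proof.
apply: (rec_app2 rec2_divS); first exact: rec_nth.
apply/(rec_app1 rec1_pred)/(rec_app1 rec1_exp2)/rec_succS/(rec_app1 rec1_head).
exact: rec_nth.
Qed.

Definition code_cons x s := 2 ^ x * s.*2.+1.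

Lemma rec2_cons : rec2 code_cons.
Proof.
apply: (rec_app2 rec2_mul); first by apply: (rec_app1 rec1_exp2);
  apply: rec_nth.
apply: rec_succS; apply: (rec_ext
  (f := fun v : 2.-tuple nat => nth 0 v 1 + nth 0 v 1)).
  by move=> v; rewrite addnn.
by apply: (rec_app2 rec2_add); apply: rec_nth.
Qed.

Lemma rec2_pair : rec2 code_pair.
Proof.
apply: (rec_app2 rec2_cons); first exact: rec_nth.
by apply: (rec_app2 rec2_cons); [apply: rec_nth|apply: rec_cst].
Qed.

Definition code_fst := code_head.
Definition code_snd z := code_head (code_tail z).

Lemma code_pairK1 x y : code_fst (code_pair x y) = x. Proof. exact:
  code_headE. Qed.
Lemma code_pairK2 x y : code_snd (code_pair x y) = y.
Proof. by rewrite /code_snd /code_pair /= code_tailE code_headE. Qed.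

Lemma rec1_fst : rec1 code_fst. Proof. exact: rec1_head. Qed.
Lemma rec1_snd : rec1 code_snd.
Proof. by apply/(rec_app1 rec1_head)/(rec_app1 rec1_tail)/rec_nth. Qed.

Definition nat_if b x y := if b is _.+1 then x else y : nat.
Lemma rec3_cond : rec3 nat_if.
Proof.
apply: (rec3_primrec (a := fun _ y => y) (g := fun _ x _ => x)) => //;
  exact: rec_nth.
Qed.

Lemma computableP (A B : countType) (f : A -> B) :
  computable f <-> exists2 g, rec1 g & forall a, g (pickle a) = pickle (f a).
Proof.
split=> [[g rg gE]|[g rg gE]];
  last by exists (fun v : 1.-tuple nat => g (nth 0 v 0)).
exists (fun x => g [tuple x]) => //; apply: rec_ext rg => v.
by congr g; apply: val_inj; case: v => -[|? []].
Qed.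

Lemma pickle_pair (A B : countType) (a : A) (b : B) :
  pickle (a, b) = code_pair (pickle a) (pickle b).
Proof. by []. Qed.
Lemma pickle_cons (A : countType) (a : A) s :
  pickle (a :: s) = code_cons (pickle a) (pickle s).
Proof. by []. Qed.
Lemma pickle_nat (n : nat) : pickle n = n.
Proof. by []. Qed.
Lemma pickle_bool (b : bool) : pickle b = b.
Proof. by []. Qed.
(** An integer is coded as an element of nat + nat, hence as a pair of options, and an option as a
    list of length at most one. *)
Lemma pickle_Posz (n : nat) : pickle (Posz n) = code_pair (code_cons n 0) 0.
Proof. by []. Qed.
Lemma pickle_Negz (n : nat) : pickle (Negz n) = code_pair 0 (code_cons n 0).
Proof. by []. Qed.
(** The code of a rational is that of its reduced fraction, so computing with rationals requires
    computing lowest terms. *)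
Lemma pickle_rat (x : rat) : pickle x = pickle (numq x, denq x).
Proof. by rewrite /numq /denq -surjective_pairing. Qed.

(** * Computable functions between countable types *)

Lemma computable_comp (A B C : countType) (f : B -> C) (a : A -> B) :
  computable f -> computable a -> computable (fun x => f (a x)).
Proof.
move=> /computableP[g rg gE] /computableP[h rh hE]; apply/computableP.
exists (fun x => g (h x)) => [|x]; last by rewrite hE gE.
exact: (rec_app1 rg).
Qed.

Lemma computable_pair (X A B : countType) (a : X -> A) (b : X -> B) :
  computable a -> computable b -> computable (fun x => (a x, b x)).
Proof.
move=> /computableP[g rg gE] /computableP[h rh hE]; apply/computableP.
exists (fun x => code_pair (g x) (h x)) => [|x]; last by rewrite hE gE.
exact: (rec_app2 rec2_pair).
Qed.

Lemma computable_id (A : countType) : computable (fun x : A => x).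
Proof. by apply/computableP; exists id => //; apply: rec_nth. Qed.

Lemma computable_cst (X A : countType) (a : A) : computable (fun _ : X => a).
Proof. by apply/computableP; exists (fun _ => pickle a) => //;
  apply: rec_cst. Qed.

Lemma computable_fst (X A B : countType) (a : X -> A * B) :
  computable a -> computable (fun x => (a x).1).
Proof.
apply: computable_comp; apply/computableP; exists code_fst;
  first exact: rec1_fst.
by case=> x y; rewrite pickle_pair code_pairK1.
Qed.

Lemma computable_snd (X A B : countType) (a : X -> A * B) :
  computable a -> computable (fun x => (a x).2).
Proof.
apply: computable_comp; apply/computableP; exists code_snd;
  first exact: rec1_snd.
by case=> x y; rewrite pickle_pair code_pairK2.
Qed.

Lemma computable_nat1 (X : countType) (f : nat -> nat) (a : X -> nat) :
  rec1 f -> computable a -> computable (fun x => f (a x)).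
Proof. by move=> rf; apply: computable_comp; apply/computableP; exists f. Qed.

Lemma computable_nat2 (X : countType) (f : nat -> nat -> nat) (a b : X -> nat) :
  rec2 f -> computable a -> computable b -> computable (fun x => f (a x) (b x)).
Proof.
move=> rf ca cb.
apply: (computable_comp (f := fun y : nat * nat => f y.1 y.2)
  (a := fun x => (a x, b x))).
  2: exact: computable_pair.
apply/computableP; exists (fun y => f (code_fst y) (code_snd y)).
  apply: (rec_app2 rf); first exact: rec1_fst.
  exact: rec1_snd.
by case=> x y; rewrite pickle_pair code_pairK1 code_pairK2.
Qed.

Lemma computable_succ (X : countType) (a : X -> nat) :
  computable a -> computable (fun x => (a x).+1).
Proof. by apply: computable_nat1; apply/rec_succS/rec_nth. Qed.

Lemma computable_pred (X : countType) (a : X -> nat) :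
  computable a -> computable (fun x => (a x).-1).
Proof. exact: (computable_nat1 rec1_pred). Qed.

Lemma computable_add (X : countType) (a b : X -> nat) :
  computable a -> computable b -> computable (fun x => a x + b x).
Proof. exact: (computable_nat2 rec2_add). Qed.

Lemma computable_sub (X : countType) (a b : X -> nat) :
  computable a -> computable b -> computable (fun x => a x - b x).
Proof. exact: (computable_nat2 rec2_sub). Qed.

Lemma computable_mul (X : countType) (a b : X -> nat) :
  computable a -> computable b -> computable (fun x => a x * b x).
Proof. exact: (computable_nat2 rec2_mul). Qed.

Lemma computable_divS (X : countType) (a b : X -> nat) :
  computable a -> computable b -> computable (fun x => a x %/ (b x).+1).
Proof. exact: (computable_nat2 rec2_divS). Qed.

Lemma computable_if (X A : countType) (b : X -> bool) (f g : X -> A) :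
  computable b -> computable f -> computable g ->
  computable (fun x => if b x then f x else g x).
Proof.
move=> /computableP[b' rb bE] /computableP[f' rf fE] /computableP[g' rg gE].
apply/computableP; exists (fun x => nat_if (b' x) (f' x) (g' x)).
  exact: (rec_app3 rec3_cond).
by move=> x; rewrite bE fE gE pickle_bool; case: (b x).
Qed.

Lemma computable_bool (X : countType) (b : X -> bool) :
  computable (fun x => nat_of_bool (b x)) -> computable b.
Proof. by move=> /computableP[g rg gE]; apply/computableP; exists g. Qed.

Lemma computable_leq (X : countType) (a b : X -> nat) :
  computable a -> computable b -> computable (fun x => a x <= b x).
Proof.
move=> ca cb; apply: computable_bool.
have cc : computable (fun x => 1 - (a x - b x)).
  by apply: computable_sub; [apply: computable_cst|apply: computable_sub].
case: cc => g rg gE; exists g => // x; rewrite gE; congr pickle.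
by rewrite /leq; case: (a x - b x).
Qed.

Lemma computable_eqn (X : countType) (a b : X -> nat) :
  computable a -> computable b -> computable (fun x => a x == b x).
Proof.
move=> ca cb; have : computable
  (fun x => if a x <= b x then b x <= a x else false).
  by apply: computable_if; [apply: computable_leq|apply: computable_leq|apply:
    computable_cst].
by case=> g rg gE; exists g => // x; rewrite gE eqn_leq; case: leq.
Qed.

Lemma computable_ext (X A : countType) (f g : X -> A) : f =1 g ->
  computable f -> computable g.
Proof. by move=> fg [h rh hE]; exists h => // x; rewrite hE fg. Qed.

(** The loops below all reduce to this one. On codes it is a primitive recursion on the number of
    steps, with x and the initial value as parameters. *)
Lemma computable_iter (X A : countType) (h : X -> nat) (a : X -> A)
  (g : X * A -> A) :
  computable h -> computable a -> computable g ->
  computable (fun x => iter (h x) (fun y => g (x, y)) (a x)).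
Proof.
move=> /computableP[h' rh hE] /computableP[a' ra aE] /computableP[g' rg gE].
apply/computableP.
have r3 : rec3 (fun n x y => iter n (fun y => g' (code_pair x y)) y).
  apply: (rec3_primrec (a := fun _ y => y)
    (g := fun y x _ => g' (code_pair x y))) => //.
    exact: rec_nth.
  by apply: (rec_app1 rg); apply: (rec_app2 rec2_pair); apply: rec_nth.
exists (fun x => iter (h' x) (fun y => g' (code_pair x y)) (a' x)).
  by apply: (rec_app3 r3) => //; apply: rec_nth.
move=> x; rewrite hE aE pickle_nat; elim: (h x) => //= n ->.
by rewrite -pickle_pair gE.
Qed.

Lemma computable_nil (X A : countType) : computable (fun _ : X => [::] : seq A).
Proof. exact: computable_cst. Qed.

Lemma computable_cons (X A : countType) (a : X -> A) (s : X -> seq A) :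
  computable a -> computable s -> computable (fun x => a x :: s x).
Proof.
move=> /computableP[g rg gE] /computableP[h rh hE]; apply/computableP.
exists (fun x => code_cons (g x) (h x)) => [|x]; last by rewrite hE gE.
exact: (rec_app2 rec2_cons).
Qed.

(** The empty list has code 0 and any other list a positive code, so the code itself serves as the
    test. *)
Lemma computable_case_seq (X A B : countType) (s : X -> seq A) (f : X -> B)
  (g : X * A * seq A -> B) :
  computable s -> computable f -> computable g ->
  computable (fun x => if s x is b :: t then g (x, b, t) else f x).
Proof.
move=> /computableP[s' rs sE] /computableP[f' rf fE] /computableP[g' rg gE].
apply/computableP.
exists (fun x => nat_if (s' x)
  (g' (code_pair (code_pair x (code_head (s' x))) (code_tail (s' x)))) (f' x)).
  apply: (rec_app3 rec3_cond) => //; apply: (rec_app1 rg).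
  apply: (rec_app2 rec2_pair); last exact: (rec_app1 rec1_tail).
  by apply: (rec_app2 rec2_pair);
    [apply: rec_nth | apply: (rec_app1 rec1_head)].
move=> x; rewrite sE fE; case: (s x) => [|b t] //.
rewrite pickle_cons /code_cons code_headE code_tailE -!pickle_pair gE.
have : 0 < 2 ^ pickle b * (pickle t).*2.+1 by rewrite muln_gt0 expn_gt0.
by case: (2 ^ _ * _).
Qed.

(** This allows the code to serve as the iteration count of a fold: once the list is used up, the
    remaining steps change nothing. *)
Lemma size_pickle (A : countType) (s : seq A) : size s <= pickle s.
Proof.
elim: s => // b t IH; rewrite pickle_cons /code_cons /=.
have : 0 < 2 ^ pickle b by rewrite expn_gt0.
by move: IH; nia.
Qed.

Lemma computable_foldl (X A B : countType) (s : X -> seq B) (a : X -> A)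
  (g : X * A * B -> A) :
  computable s -> computable a -> computable g ->
  computable (fun x => foldl (fun z b => g (x, z, b)) (a x) (s x)).
Proof.
move=> cs ca cg.
pose step (y : X * (A * seq B)) : A * seq B :=
  if y.2.2 is b :: t then (g (y.1, y.2.1, b), t) else y.2.
have cstep : computable step.
  apply: (computable_case_seq (g :=
    fun z => (g (z.1.1.1, z.1.1.2.1, z.1.2), z.2))).
  - by apply/computable_snd/computable_snd/computable_id.
  - by apply/computable_snd/computable_id.
  apply: computable_pair; last by apply/computable_snd/computable_id.
  apply: (computable_comp cg); apply: computable_pair;
    last by apply/computable_snd/computable_fst/computable_id.
  by apply: computable_pair; [apply/computable_fst/computable_fst/computable_fst/computable_id | apply/computable_fst/computable_snd/computable_fst/computable_fst/computable_id].
have cn : computable (fun x => pickle (s x)).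
  by case: cs => g' rg gE; exists g' => // x; rewrite gE.
apply: computable_ext (computable_fst
  (computable_iter cn (computable_pair ca cs) cstep)) => x.
suff H n z t : size t <= n ->
    (iter n (fun y => step (x, y)) (z, t)).1 =
      foldl (fun z b => g (x, z, b)) z t.
  exact/H/size_pickle.
elim: n z t => [|n IHn] z t; first by case: t.
rewrite iterSr /step /=; case: t => [|b t] /= le_t; last exact: IHn.
by rewrite (IHn _ [::]).
Qed.

Lemma computable_rev (X A : countType) (s : X -> seq A) :
  computable s -> computable (fun x => rev (s x)).
Proof.
move=> cs.
have cg : computable (fun y : X * seq A * A => y.2 :: y.1.2).
  by apply: computable_cons; [apply/computable_snd/computable_id |
    apply/computable_snd/computable_fst/computable_id].
apply: computable_ext (computable_foldl cs (computable_nil X A) cg) => x.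
by rewrite -[s x]revK foldl_rev revK; elim: (rev _) => //= b t ->.
Qed.

Lemma computable_foldr (X A B : countType) (s : X -> seq B) (a : X -> A)
  (g : X * B * A -> A) :
  computable s -> computable a -> computable g ->
  computable (fun x => foldr (fun b z => g (x, b, z)) (a x) (s x)).
Proof.
move=> cs ca cg.
have cg' : computable (fun y : X * A * B => g (y.1.1, y.2, y.1.2)).
  apply: (computable_comp cg); apply: computable_pair;
    last by apply/computable_snd/computable_fst/computable_id.
  by apply: computable_pair; [apply/computable_fst/computable_fst/computable_id
    | apply/computable_snd/computable_id].
by apply: computable_ext (computable_foldl (computable_rev cs) ca cg') => x;
  rewrite foldl_rev.
Qed.

Lemma computable_map (X A B : countType) (s : X -> seq A) (g : X -> A -> B) :
  computable s -> computable (fun y : X * A => g y.1 y.2) ->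
  computable (fun x => [seq g x b | b <- s x]).
Proof.
move=> cs cg.
apply: computable_ext (computable_foldr (g := fun y => g y.1.1 y.1.2 :: y.2) cs
  (computable_nil X B) _) => [x|].
  by elim: (s x) => //= b t ->.
apply: computable_cons; last by apply/computable_snd/computable_id.
by apply: (computable_comp (f := fun y : X * A => g y.1 y.2) cg);
  apply/computable_fst/computable_id.
Qed.

Lemma computable_cat (X A : countType) (s t : X -> seq A) :
  computable s -> computable t -> computable (fun x => s x ++ t x).
Proof.
move=> cs ct.
apply: computable_ext (computable_foldr (g := fun y => y.1.2 :: y.2) cs ct _)
  => [x|].
  by elim: (s x) => //= b u ->.
by apply: computable_cons; [apply/computable_snd/computable_fst/computable_id |
  apply/computable_snd/computable_id].
Qed.

Lemma computable_flatten (X A : countType) (s : X -> seq (seq A)) :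
  computable s -> computable (fun x => flatten (s x)).
Proof.
move=> cs.
apply: (computable_foldr (g := fun y => y.1.2 ++ y.2) cs
  (computable_nil X A) _).
by apply: computable_cat; [apply/computable_snd/computable_fst/computable_id |
  apply/computable_snd/computable_id].
Qed.

Lemma computable_filter (X A : countType) (s : X -> seq A)
  (g : X -> A -> bool) :
  computable s -> computable (fun y : X * A => g y.1 y.2) ->
  computable (fun x => [seq b <- s x | g x b]).
Proof.
move=> cs cg.
pose f (y : X * A * seq A) := if g y.1.1 y.1.2 then y.1.2 :: y.2 else y.2.
apply: computable_ext (computable_foldr (g := f) cs (computable_nil X A) _) =>
  [x|].
  by elim: (s x) => //= b t ->.
have c2 : computable (fun x : X * A * seq A => x.2)
  by apply/computable_snd/computable_id.
apply: computable_if => //.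
  by apply: (computable_comp (f := fun y : X * A => g y.1 y.2) cg);
    apply/computable_fst/computable_id.
by apply: computable_cons => //;
  apply/computable_snd/computable_fst/computable_id.
Qed.

Lemma computable_iota (X : countType) (a : X -> nat) :
  computable a -> computable (fun x => iota 0 (a x)).
Proof.
move=> ca.
(* Counting down lets each new entry be put in front: after i steps the list runs from a - i to a -
   1. *)
pose step (y : X * (nat * seq nat)) := (y.2.1.-1, y.2.1.-1 :: y.2.2).
have cstep : computable step.
  have cp : computable (fun y : X * (nat * seq nat) => y.2.1.-1).
    by apply/computable_pred/computable_fst/computable_snd/computable_id.
  by apply: computable_pair => //; apply: computable_cons => //;
    apply/computable_snd/computable_snd/computable_id.
apply: computable_ext (computable_snd
  (computable_iter ca (computable_pair ca (computable_nil X nat)) cstep)) => x.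
suff H i : i <= a x -> iter i (fun y => step (x, y)) (a x, [::]) =
  (a x - i, iota (a x - i) i).
  by rewrite H // subnn.
elim: i => [|i IH] lt_i; rewrite /= ?subn0 // IH 1?ltnW // /step /=.
by rewrite -subnS; congr (_, _ :: iota _ _); rewrite subnSK.
Qed.

Lemma computable_fact (X : countType) (a : X -> nat) :
  computable a -> computable (fun x => (a x)`!).
Proof.
move=> ca.
apply: computable_ext (computable_foldl
  (g := fun y : X * nat * nat => y.1.2 * y.2.+1) (computable_iota ca)
  (computable_cst X 1) _) => [x|].
  elim: (a x) => // n IH; have -> : iota 0 n.+1 = rcons (iota 0 n) n.
    by rewrite -cats1 -[n.+1]addn1 iotaD.
  by rewrite foldl_rcons IH factS mulnC.
by apply: computable_mul; [apply/computable_snd/computable_fst/computable_id |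
  apply/computable_succ/computable_snd/computable_id].
Qed.

Import GRing.Theory Num.Theory.
Local Open Scope ring_scope.

(** * Integers and rationals *)

Lemma computable_Posz (X : countType) (a : X -> nat) :
  computable a -> computable (fun x => Posz (a x)).
Proof.
move=> /computableP[g rg gE]; apply/computableP.
exists (fun x => code_pair (code_cons (g x) 0) 0) => [|x];
  last by rewrite gE pickle_Posz.
apply: (rec_app2 rec2_pair); last exact: rec_cst.
by apply: (rec_app2 rec2_cons) => //; apply: rec_cst.
Qed.

Lemma computable_Negz (X : countType) (a : X -> nat) :
  computable a -> computable (fun x => Negz (a x)).
Proof.
move=> /computableP[g rg gE]; apply/computableP.
exists (fun x => code_pair 0 (code_cons (g x) 0)) => [|x];
  last by rewrite gE pickle_Negz.
apply: (rec_app2 rec2_pair); first exact: rec_cst.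
by apply: (rec_app2 rec2_cons) => //; apply: rec_cst.
Qed.

Lemma computable_case_int (X A : countType) (z : X -> int)
  (f g : X * nat -> A) :
  computable z -> computable f -> computable g ->
  computable (fun x => match z x with Posz n => f (x, n) | Negz n =>
    g (x, n) end).
Proof.
move=> /computableP[z' rz zE] /computableP[f' rf fE] /computableP[g' rg gE].
apply/computableP.
exists (fun x => nat_if (code_fst (z' x))
  (f' (code_pair x (code_head (code_fst (z' x)))))
                                     (g' (code_pair x (code_head (code_snd
                                       (z' x)))))).
  have r0 : recursive (fun v : 1.-tuple nat => nth 0%N v 0) by apply: rec_nth.
  apply: (rec_app3 rec3_cond); first exact: (rec_app1 rec1_fst).
    apply: (rec_app1 rf); apply: (rec_app2 rec2_pair) => //.
    by apply/(rec_app1 rec1_head)/(rec_app1 rec1_fst).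
  apply: (rec_app1 rg); apply: (rec_app2 rec2_pair) => //.
  by apply/(rec_app1 rec1_head)/(rec_app1 rec1_snd).
move=> x; rewrite zE; case: (z x) => n.
  rewrite pickle_Posz code_pairK1 /code_cons code_headE -[in LHS](pickle_nat n)
    -pickle_pair fE.
  have : (0 < 2 ^ pickle n * 0.*2.+1)%N by rewrite muln_gt0 expn_gt0.
  by case: (_ * _)%N.
by rewrite pickle_Negz code_pairK1 code_pairK2 /code_cons code_headE
  -[in LHS](pickle_nat n) -pickle_pair gE.
Qed.

Lemma computable_oppn (X : countType) (a : X -> nat) :
  computable a -> computable (fun x => - (a x)%:Z).
Proof.
move=> ca; have : computable
  (fun x => if a x == 0%N then Posz 0 else Negz (a x).-1).
  apply: computable_if; [apply: computable_eqn => //;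
    apply: computable_cst | exact: computable_cst |].
  by apply/computable_Negz/computable_pred.
by apply: computable_ext => x; case: (a x).
Qed.

Lemma computable_subz (X : countType) (a b : X -> nat) :
  computable a -> computable b -> computable (fun x => (a x)%:Z - (b x)%:Z).
Proof.
move=> ca cb.
have : computable (fun x => if (b x <= a x)%N then Posz (a x - b x) else -
  (b x - a x)%N%:Z).
  by apply: computable_if; [apply:
    computable_leq | apply/computable_Posz/computable_sub |
    apply/computable_oppn/computable_sub].
by apply: computable_ext => x; case: ifP => h; lia.
Qed.

Lemma computable_addz (X : countType) (a b : X -> int) :
  computable a -> computable b -> computable (fun x => a x + b x).
Proof.
move=> ca cb.
pose f (y : X * nat) := match b y.1 with Posz n => Posz (y.2 + n) | Negz n =>
  y.2%:Z - n.+1%:Z end.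
pose g (y : X * nat) := match b y.1 with Posz n => n%:Z - y.2.+1%:Z | Negz n =>
  - (y.2.+1 + n.+1)%N%:Z end.
have cb1 : computable (fun y : X * nat => b y.1)
  by apply/(computable_comp cb)/computable_fst/computable_id.
have c1 : computable (fun y : X * nat * nat => y.1.2)
  by apply/computable_snd/computable_fst/computable_id.
have c2 : computable (fun y : X * nat * nat => y.2)
  by apply/computable_snd/computable_id.
have cf : computable f.
  apply: (computable_case_int (f := fun y : X * nat * nat => Posz (y.1.2 + y.2))
                     (g := fun y => y.1.2%:Z - y.2.+1%:Z)) => //.
    by apply/computable_Posz/computable_add.
  by apply/computable_subz => //; apply/computable_succ.
have cg : computable g.
  apply: (computable_case_int (f := fun y :
    X * nat * nat => y.2%:Z - y.1.2.+1%:Z)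
                     (g := fun y => - (y.1.2.+1 + y.2.+1)%N%:Z)) => //.
    by apply/computable_subz => //; apply/computable_succ.
  by apply/computable_oppn/computable_add; apply/computable_succ.
by apply: computable_ext (computable_case_int ca cf cg) => x; rewrite /f /g /=;
  case: (a x) (b x) => m [] n; lia.
Qed.

Lemma computable_mulz (X : countType) (a b : X -> int) :
  computable a -> computable b -> computable (fun x => a x * b x).
Proof.
move=> ca cb.
pose f (y : X * nat) := match b y.1 with Posz n => Posz (y.2 * n) | Negz n =>
  - (y.2 * n.+1)%N%:Z end.
pose g (y : X * nat) := match b y.1 with Posz n =>
  - (y.2.+1 * n)%N%:Z | Negz n => Posz (y.2.+1 * n.+1) end.
have cb1 : computable (fun y : X * nat => b y.1)
  by apply/(computable_comp cb)/computable_fst/computable_id.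
have c1 : computable (fun y : X * nat * nat => y.1.2)
  by apply/computable_snd/computable_fst/computable_id.
have c2 : computable (fun y : X * nat * nat => y.2)
  by apply/computable_snd/computable_id.
have cf : computable f.
  apply: (computable_case_int (f := fun y : X * nat * nat => Posz (y.1.2 * y.2))
                     (g := fun y => - (y.1.2 * y.2.+1)%N%:Z)) => //.
    by apply/computable_Posz/computable_mul.
  by apply/computable_oppn/computable_mul => //; apply/computable_succ.
have cg : computable g.
  apply: (computable_case_int (f := fun y :
    X * nat * nat => - (y.1.2.+1 * y.2)%N%:Z)
                     (g := fun y => Posz (y.1.2.+1 * y.2.+1))) => //.
    by apply/computable_oppn/computable_mul => //; apply/computable_succ.
  by apply/computable_Posz/computable_mul; apply/computable_succ.
by apply: computable_ext (computable_case_int ca cf cg) => x; rewrite /f /g /=;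
  case: (a x) (b x) => m [] n; nia.
Qed.

Lemma computable_absz (X : countType) (a : X -> int) :
  computable a -> computable (fun x => `|a x|%N).
Proof.
move=> ca.
apply: computable_ext (computable_case_int (f := fun y : X * nat => y.2)
  (g := fun y => y.2.+1) ca _ _) => [x||].
- by case: (a x).
- by apply/computable_snd/computable_id.
- by apply/computable_succ/computable_snd/computable_id.
Qed.

Definition reduced_den a b := (b.+1 %/ gcdn a b.+1)%N.

Lemma reduced_den_min a b d : (0 < d)%N -> (b.+1 %| a * d)%N ->
  (reduced_den a b <= d)%N.
Proof.
move=> d_gt0 h; apply: dvdn_leq => //; rewrite /reduced_den.
have g0 : (0 < gcdn a b.+1)%N by rewrite gcdn_gt0 orbT.
rewrite -(@dvdn_pmul2r (gcdn a b.+1)) // divnK ?dvdn_gcdr //.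
by rewrite mulnC muln_gcdl dvdn_gcd h dvdn_mulr.
Qed.

(** The reduced denominator is the least d > 0 such that b + 1 divides a d, so minimisation finds it
    without a recursive gcd. The summand 1 - d rules out d = 0. *)
Lemma rec2_reduced_den : rec2 reduced_den.
Proof.
apply: (rec2_min (f := fun d a b =>
  (1 - d) + (a * d - a * d %/ b.+1 * b.+1))%N).
- apply: (rec_app2 rec2_add).
    by apply: (rec_app2 rec2_sub); [apply: rec_cst|apply: rec_nth].
  have rm : recursive (fun v : 3.-tuple nat => nth 0%N v 1 * nth 0%N v 0)%N.
    by apply: (rec_app2 rec2_mul); apply: rec_nth.
  apply: (rec_app2 rec2_sub) => //; apply: (rec_app2 rec2_mul).
    by apply: (rec_app2 rec2_divS) => //; apply: rec_nth.
  by apply/rec_succS/rec_nth.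
- move=> a b; rewrite subn_divn_mul.
  have g0 : (0 < gcdn a b.+1)%N by rewrite gcdn_gt0 orbT.
  have d0 : (0 < reduced_den a b)%N
    by rewrite /reduced_den divn_gt0 // dvdn_leq ?dvdn_gcdr.
  have /eqP -> : (b.+1 %| a * reduced_den a b)%N; last by lia.
  rewrite /reduced_den muln_divA ?dvdn_gcdr // mulnC -muln_divA ?dvdn_gcdl //.
  exact: dvdn_mulr.
- move=> a b d lt_d; rewrite subn_divn_mul => h.
  have : (reduced_den a b <= d)%N by apply: reduced_den_min;
    [lia | apply/eqP; lia].
  by rewrite leqNgt lt_d.
Qed.

Lemma computable_rat (X : countType) (q : X -> rat) (n d : X -> int) :
  (forall x, numq (q x) = n x) -> (forall x, denq (q x) = d x) ->
  computable n -> computable d -> computable q.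
Proof.
move=> qn qd cn cd; have [g rg gE] := computable_pair cn cd; exists g => // x.
by rewrite gE pickle_rat qn qd.
Qed.

Lemma computable_numq (X : countType) (q : X -> rat) : computable q ->
  computable (fun x => numq (q x)).
Proof.
move=> [g rg gE]; have : computable (fun x => (numq (q x), denq (q x))).
  by exists g => // x; rewrite gE pickle_rat.
exact: computable_fst.
Qed.

Lemma computable_denq (X : countType) (q : X -> rat) : computable q ->
  computable (fun x => denq (q x)).
Proof.
move=> [g rg gE]; have : computable (fun x => (numq (q x), denq (q x))).
  by exists g => // x; rewrite gE pickle_rat.
exact: computable_snd.
Qed.

Lemma computable_frac (X : countType) (a : X -> int) (b : X -> nat) :
  computable a -> computable b ->
  computable (fun x => (a x)%:~R / (b x).+1%:R : rat).
Proof.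
move=> ca cb.
pose d x := reduced_den `|a x| (b x).
pose m x := (`|a x| * d x %/ (b x).+1)%N.
have cabs : computable (fun x => `|a x|%N) by apply: computable_absz.
have cd : computable d by apply: (computable_nat2 rec2_reduced_den).
have cm : computable m by apply: computable_divS => //; apply: computable_mul.
pose s x := if a x is Posz _ then (m x)%:Z else - (m x)%:Z.
have cs : computable s.
  apply: (computable_case_int (f := fun y : X * nat => (m y.1)%:Z)
    (g := fun y => - (m y.1)%:Z) ca).
    by apply/computable_Posz/(computable_comp cm)/computable_fst/computable_id.
  by apply/computable_oppn/(computable_comp cm)/computable_fst/computable_id.
(* These three facts identify s / d as the reduced form of a / (b + 1), hence as the pair that
   [pickle] codes. *)
have key x : [/\ (0 < d x)%N, coprime (m x) (d x) & (s x) * (b x).+1 =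
  a x * d x].
  have g0 : (0 < gcdn `|a x| (b x).+1)%N by rewrite gcdn_gt0 orbT.
  have d0 : (0 < d x)%N by rewrite /d /reduced_den divn_gt0 // dvdn_leq
    ?dvdn_gcdr.
  have mE : (m x = `|a x| %/ gcdn `|a x| (b x).+1)%N.
    rewrite /m /d /reduced_den muln_divA ?dvdn_gcdr // mulnC -muln_divA
      ?dvdn_gcdl //.
    by rewrite mulKn.
  have mb : (m x * (b x).+1 = `|a x| * d x)%N.
    rewrite mE /d /reduced_den muln_divA ?dvdn_gcdr // [in RHS]mulnC
      [(_ * _.+1)%N]mulnC.
    by rewrite muln_divA ?dvdn_gcdl // mulnC.
  split=> //.
    rewrite /coprime mE /d /reduced_den -(@eqn_pmul2r (gcdn `|a x| (b x).+1))
      // mul1n.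
    by rewrite muln_gcdl !divnK ?dvdn_gcdl ?dvdn_gcdr.
  by rewrite /s; case: (a x) mb => /= u; lia.
have qE x : (a x)%:~R / (b x).+1%:R = (s x)%:~R / (d x)%:Z%:~R :> rat.
  have [d0 _ e] := key x.
  apply/eqP; rewrite eqr_div ?pnatr_eq0 // ?intr_eq0; last by lia.
  by rewrite -[(b x).+1%:R]/((b x).+1%:Z%:~R) -!intrM eqr_int e.
have abs_s x : `|s x|%N = m x by rewrite /s; case: (a x); lia.
apply: (computable_rat (n := s) (d := fun x => (d x)%:Z)) => //;
  last exact: computable_Posz.
  move=> x; have [d0 co _] := key x;
    rewrite qE coprimeq_num ?abs_s // gtr0_sg ?mul1r //.
by move=> x; have [d0 co _] := key x; rewrite qE coprimeq_den ?abs_s //;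
  case: eqP => //; lia.
Qed.

Lemma computable_mulq (X : countType) (a b : X -> rat) :
  computable a -> computable b -> computable (fun x => a x * b x).
Proof.
move=> ca cb.
have : computable (fun x => (numq (a x) * numq (b x))%:~R /
   ((`|denq (a x)| * `|denq (b x)|).-1.+1)%:R : rat).
  apply: computable_frac; first by apply: computable_mulz;
    apply: computable_numq.
  by apply/computable_pred/computable_mul;
    apply/computable_absz/computable_denq.
apply: computable_ext => x; rewrite prednK;
  last by rewrite muln_gt0 !absz_gt0 !denq_neq0.
rewrite -[a x in RHS]divq_num_den -[b x in RHS]divq_num_den mulf_div -!intrM;
  congr (_%:~R / _).
by rewrite -[LHS]/(Posz (_ * _))%:~R PoszM !absz_denq.
Qed.

Lemma computable_expq (X : countType) (a : X -> rat) (n : X -> nat) :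
  computable a -> computable n -> computable (fun x => a x ^+ n x).
Proof.
move=> ca cn.
apply: computable_ext (computable_iter (g := fun y : X * rat => a y.1 * y.2) cn
  (computable_cst X (1 : rat)) _) => [x|].
  by elim: (n x) => //= m ->; rewrite exprS.
by apply: computable_mulq; [apply/(computable_comp
  ca)/computable_fst/computable_id|apply/computable_snd/computable_id].
Qed.

(** * The list of terms *)

Lemma computable_divnn (X : countType) (a b : X -> nat) :
  (forall x, 0 < b x)%N ->
  computable a -> computable b ->
    computable (fun x => (a x)%:R / (b x)%:R : rat).
Proof.
move=> b0 ca cb; have : computable
  (fun x => (a x)%:Z%:~R / (b x).-1.+1%:R : rat).
  by apply: computable_frac; [apply: computable_Posz | apply: computable_pred].
by apply: computable_ext => x; rewrite prednK.
Qed.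

Lemma computable_natq (X : countType) (a : X -> nat) :
  computable a -> computable (fun x => (a x)%:R : rat).
Proof.
move=> ca; have := computable_divnn (b := fun=> 1%N) (fun=> isT) ca
  (computable_cst _ _).
by apply: computable_ext => x; rewrite divr1.
Qed.

(* (d, (s, c, b)) stands for c * p ^ b * H_{p-1}(s) * t ^ d. *)
Definition mono : countType := (nat * mhs_term)%type.

Definition mk_mono (t : nat) (s : seq nat) (c : rat) (b : int) : mono :=
  (t, (s, c, b)).
Definition mono_deg (m : mono) : nat := m.1.
Definition mono_term (m : mono) : mhs_term := m.2.

Lemma computable_mono (X : countType) t s c b :
  computable t -> computable s -> computable c -> computable b ->
  computable (fun x : X => mk_mono (t x) (s x) (c x) (b x)).
Proof. by move=> ct cs cc cb; apply/computable_pair/computable_pair => //;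
  apply: computable_pair. Qed.

Lemma computable_deg (X : countType) (m : X -> mono) : computable m ->
  computable (fun x => mono_deg (m x)).
Proof. exact: computable_fst. Qed.
Lemma computable_term (X : countType) (m : X -> mono) : computable m ->
  computable (fun x => mono_term (m x)).
Proof. exact: computable_snd. Qed.
Lemma computable_tcomp (X : countType) (m : X -> mhs_term) : computable m ->
  computable (fun x => term_comp (m x)).
Proof. by move=> cm; apply/computable_fst/computable_fst. Qed.
Lemma computable_tcoef (X : countType) (m : X -> mhs_term) : computable m ->
  computable (fun x => term_coef (m x)).
Proof. by move=> cm; apply/computable_snd/computable_fst. Qed.
Lemma computable_texpo (X : countType) (m : X -> mhs_term) : computable m ->
  computable (fun x => term_expo (m x)).
Proof. exact: computable_snd. Qed.

(** Concatenation does not compute a product of harmonic sums. It is used where one factor has an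
    empty composition, and to string letters into words. *)
Definition mono_mul (x y : mono) : mono :=
  mk_mono (mono_deg x + mono_deg y)
    (term_comp (mono_term x) ++ term_comp (mono_term y))
    (term_coef (mono_term x) * term_coef (mono_term y))
    (term_expo (mono_term x) + term_expo (mono_term y)).

(** Ring products are read as products of rationals and ring sums as sums of integers: terms
    multiply their coefficients and add their exponents. *)
Ltac comp_step :=
  lazymatch goal with
  | |- computable (fun x => x) => apply: computable_id
  | |- computable (fun _ => ?c) => apply: computable_cst
  | H : computable ?f |- computable (fun x => ?f x) => exact H
  | H : computable ?f |- computable ?f => exact H
  | |- computable (fun x => mk_mono _ _ _ _) => apply: computable_mono
  | |- computable (fun x => mono_deg _) => apply: computable_deg
  | |- computable (fun x => mono_term _) => apply: computable_term
  | |- computable (fun x => term_comp _) => apply: computable_tcomp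
  | |- computable (fun x => term_coef _) => apply: computable_tcoef
  | |- computable (fun x => term_expo _) => apply: computable_texpo
  | |- computable (fun x => cons _ _) => apply: computable_cons
  | |- computable (fun x => cat _ _) => apply: computable_cat
  | |- computable (fun x => iota 0 _) => apply: computable_iota
  | |- computable (fun x => GRing.mul _ _) => apply: computable_mulq
  | |- computable (fun x => GRing.exp _ _) => apply: computable_expq
  | |- computable (fun x => GRing.natmul _ _) => apply: computable_natq
  | |- computable (fun x => GRing.add _ _) => apply: computable_addz
  | |- computable (@fst _ _) => exact: (computable_fst (computable_id _))
  | |- computable (@snd _ _) => exact: (computable_snd (computable_id _))
  | |- computable (fun x => absz _) => apply: computable_absz
  | |- computable (fun x => Posz _) => apply: computable_Posz
  | |- computable (fun x => S _) => apply: computable_succ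
  | |- computable (fun x => predn _) => apply: computable_pred
  | |- computable (fun x => addn _ _) => apply: computable_add
  | |- computable (fun x => subn _ _) => apply: computable_sub
  | |- computable (fun x => muln _ _) => apply: computable_mul
  | |- computable (fun x => factorial _) => apply: computable_fact
  | |- computable (fun x => leq _ _) => apply: computable_leq
  | |- computable (fun x => @eq_op Datatypes_nat__canonical__eqtype_Equality _
    _) => apply: computable_eqn
  | |- computable (fun x => pair _ _) => apply: computable_pair
  | |- computable (fun x => fst _) => apply: computable_fst
  | |- computable (fun x => snd _) => apply: computable_snd
  end.
Ltac comp := repeat comp_step.

Lemma computable_mono_mul (X : countType) (a b : X -> mono) :
  computable a -> computable b -> computable (fun x => mono_mul (a x) (b x)).
Proof. by move=> ca cb; rewrite /mono_mul; comp. Qed.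

Definition mono1 : mono := mk_mono 0 [::] 1 0.

Definition lmul (s t : seq mono) : seq mono :=
  flatten [seq [seq mono_mul x y | y <- t] | x <- s].

Lemma computable_lmul (X : countType) (a b : X -> seq mono) :
  computable a -> computable b -> computable (fun x => lmul (a x) (b x)).
Proof.
move=> ca cb; rewrite /lmul; apply: computable_flatten;
  apply: computable_map => //; apply: computable_map.
  by apply: (computable_comp cb); comp.
by apply: computable_mono_mul; comp.
Qed.

Definition lprod (s : seq (seq mono)) : seq mono := foldr lmul [:: mono1] s.

Lemma computable_lprod (X : countType) (a : X -> seq (seq mono)) :
  computable a -> computable (fun x => lprod (a x)).
Proof.
move=> ca; have cm : computable
  (fun y : X * seq mono * seq mono => lmul y.1.2 y.2).
  by apply: computable_lmul; comp.
exact: (computable_foldr (g := fun y => lmul y.1.2 y.2) ca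
  (computable_cst X [:: mono1]) cm).
Qed.

(* P - (q + 1), with P = p ^ (r - 1) *)
Definition Pfactor (r q : nat) : seq mono :=
  [:: mk_mono 0 [::] 1 r.-1; mk_mono 0 [::] (-1 * q.+1%:R) 0].

(* t / p + q *)
Definition ufactor (q : nat) : seq mono :=
  [:: mk_mono 1 [::] 1 (-1); mk_mono 0 [::] q%:R 0].

(* 1 + t / (a + p * j) with E terms of its p-adic expansion kept. The powers of
   1 / a are left implicit: t ^ d * p ^ b always comes with a ^- (d + b), which
   [close_letter] turns into an entry of the composition. *)
Definition lfactor (E j : nat) : seq mono :=
  mono1 :: [seq mk_mono 1 [::] ((-1 * j%:R) ^+ b) b | b <- iota 0 E].

Definition close_letter (m : mono) : mono :=
  mk_mono (mono_deg m) [:: (mono_deg m + `|term_expo (mono_term m)|)%N]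
    (term_coef (mono_term m)) (term_expo (mono_term m)).

(** The degree 0 part of the product over j is its constant term 1. Without it every letter is
    divisible by t, which bounds the length of the words that matter. *)
Definition letters (E i : nat) : seq mono :=
  [seq close_letter m | m <- [seq m <- lprod
    [seq lfactor E j | j <- iota 0 i] | (0 < mono_deg m)%N]].

(** This is k! times the weight of W_i in the difference of order c + 1, divided by c! (c + 1)!. The
    division cancels the factorials that the products of [Pfactor] and [ufactor] carry in excess of
    binom(P - 1, c) and (t/p)^(c + 1). *)
Definition newton_coef (k c i : nat) : rat :=
  (-1) ^+ (c.+1 - i) * (k`!%:R / (i`! * (c.+1 - i)`! * c`!)%:R).

Definition block (r k E c i l : nat) : seq mono :=
  lmul [:: mk_mono 0 [::] (newton_coef k c i) 0]
    (lmul (lprod [seq Pfactor r q | q <- iota 0 c])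
       (lmul (lprod [seq ufactor q | q <- iota 0 c.+1])
          (lprod [seq letters E i | _ <- iota 0 l]))).

(** The order c + 1 of the difference runs up to the degree bound k E, i over the nodes of that
    difference, and l over the word lengths up to k. *)
Definition blocks (r k E : nat) : seq mono :=
  flatten [seq flatten [seq flatten [seq block r k E c i l
    | l <- iota 0 k.+1] | i <- iota 0 c.+2] | c <- iota 0 (k * E)].

Definition Fterms (r k n : nat) : seq mhs_term :=
  [seq mono_term m | m <- [seq m <- blocks r k (n + k * r) | mono_deg m == k]].

(** * Computability of the list of terms *)

Lemma computable_letters (X : countType) (E i : X -> nat) :
  computable E -> computable i -> computable (fun x => letters (E x) (i x)).
Proof.
move=> cE ci; rewrite /letters /close_letter; apply: computable_map;
  last by comp.
apply: computable_filter; last by comp.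
apply: computable_lprod; apply: computable_map; first by comp.
rewrite /lfactor; apply: computable_cons; first by comp.
apply: computable_map; last by comp.
by apply: computable_iota; apply: (computable_comp cE); comp.
Qed.

Lemma computable_Pfactor (X : countType) (r q : X -> nat) :
  computable r -> computable q -> computable (fun x => Pfactor (r x) (q x)).
Proof. by move=> cr cq; rewrite /Pfactor; comp. Qed.

Lemma computable_ufactor (X : countType) (q : X -> nat) :
  computable q -> computable (fun x => ufactor (q x)).
Proof. by move=> cq; rewrite /ufactor; comp. Qed.

Lemma computable_newton_coef (X : countType) (k c i : X -> nat) :
  computable k -> computable c -> computable i ->
  computable (fun x => newton_coef (k x) (c x) (i x)).
Proof.
move=> ck cc ci; apply: computable_mulq; first by comp.
by apply: computable_divnn => [x||]; [rewrite !muln_gt0 !fact_gt0| |]; comp.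
Qed.

Lemma computable_block (X : countType) (r k E c i l : X -> nat) :
  computable r -> computable k -> computable E ->
  computable c -> computable i -> computable l ->
  computable (fun x => block (r x) (k x) (E x) (c x) (i x) (l x)).
Proof.
move=> cr ck cE cc ci cl; rewrite /block; apply: computable_lmul.
  apply: computable_cons; last by comp.
  by apply: computable_mono; [comp | comp | apply:
    computable_newton_coef | comp].
apply: computable_lmul.
  apply: computable_lprod; apply: computable_map; first by comp.
  by apply: computable_Pfactor; [apply: (computable_comp cr)|]; comp.
apply: computable_lmul.
  apply: computable_lprod; apply: computable_map; first by comp.
  by apply: computable_ufactor; comp.
apply: computable_lprod; apply: computable_map; first by comp.
by apply: computable_letters;
  [apply: (computable_comp cE)|apply: (computable_comp ci)]; comp.
Qed.

Lemma computable_Fterms :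
  computable (fun x : nat * nat * nat => Fterms x.1.1 x.1.2 x.2).
Proof.
rewrite /Fterms; apply: computable_map; last by comp.
apply: computable_filter; last by comp.
rewrite /blocks; do 3! (apply: computable_flatten; apply: computable_map;
  first by comp).
by apply: computable_block; comp.
Qed.

(** * The generating function *)

Definition rising (M : nat) (x : {poly rat}) : {poly rat} :=
  M`!%:R^-1 *: \prod_(n < M) (x + n%:R).

Lemma rising0 x : rising 0 x = 1.
Proof. by rewrite /rising big_ord0 invr1 scale1r. Qed.

Lemma risingS M x : rising M.+1 x = M.+1%:R^-1 *: ((x + M%:R) * rising M x).
Proof.
by rewrite /rising big_ord_recr /=
  factS natrM invfM -scalerAr scalerA mulrC [_ * (x + _)]mulrC.
Qed.

Lemma risingSM M x : M.+1%:R * rising M.+1 x = (x + M%:R) * rising M x.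
Proof. by rewrite risingS -polyC_natr mul_polyC scalerA mulfV ?scale1r
  ?pnatr_eq0. Qed.

(** Applying y d/dy to (1 - y) ^ (- x) multiplies the series by x y / (1 - y); these are the
    coefficients of y ^ M. *)
Lemma rising_sum M x : M%:R * rising M x = x * \sum_(j < M) rising j x.
Proof.
elim: M => [|M IH]; first by rewrite big_ord0 mul0r mulr0.
by rewrite risingSM big_ord_recr /= mulrDr -IH mulrDl addrC.
Qed.

(** Multiplying (1 - y) ^ (- x - 1) by 1 - y gives (1 - y) ^ (- x). *)
Lemma rising_add1 M x : rising M.+1 (x + 1) = rising M (x + 1) + rising M.+1 x.
Proof.
have rising_shift N : (x + N%:R) * rising N x = x * rising N (x + 1).
  elim: N => [|N IH]; first by rewrite !rising0 addr0.
  by rewrite !risingS -[LHS]scalerAr -[RHS]scalerAr IH -natr1; congr (_ *: _);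
    ring.
have n0 : M.+1%:R != 0 :> {poly rat} by rewrite -polyC_natr polyC_eq0 pnatr_eq0.
apply: (mulfI n0); rewrite mulrDr !risingSM rising_shift -natr1; ring.
Qed.

Lemma rising_bin N c x : (c <= N)%N ->
  'C(N, c)%:R * rising N x = rising c x * rising (N - c) (x + c%:R).
Proof.
move=> le_cN; rewrite /rising -polyC_natr mul_polyC -scalerAl -!scalerAr
  !scalerA.
congr (_ *: _); last first.
  move: (subnKC le_cN); move: (N - c)%N => d <-; rewrite big_split_ord /=;
    congr (_ * _); apply: eq_bigr => i _.
  by rewrite natrD addrA.
have f0 n : n`!%:R != 0 :> rat by rewrite pnatr_eq0 -lt0n fact_gt0.
by rewrite -(bin_fact le_cN) !natrM; field; rewrite !f0 pnatr_eq0 -lt0n bin_gt0.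
Qed.

(** The coefficient of y ^ M in f(y) g(y ^ p), provided that D > M and p > 0: no index is then lost
    to the cutoff. *)
Definition dilated_conv (D p : nat) (f g : nat -> {poly rat}) (M : nat) :
  {poly rat} :=
  \sum_(i < D) \sum_(N < D | (i + p * N == M)%N) f i * g N.

Lemma sum_ord_eq (V : nmodType) D (P : pred nat) b a (X : V) :
  (forall i, (i < D)%N -> P i = b && (i == a)) ->
  \sum_(i < D | P i) X = if b && (a < D)%N then X else 0.
Proof.
move=> PE; case: ifP => [/andP[b1 ltaD]|nb].
  rewrite (big_pred1 (Ordinal ltaD)) // => i.
  by rewrite PE ?ltn_ord // b1.
rewrite big_pred0 // => i; rewrite PE ?ltn_ord //;
  apply/negP => /andP[b1 /eqP ia].
by rewrite b1 -ia ltn_ord in nb.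
Qed.

(** The logarithmic derivative y F' / F of F = (1 - y) ^ (- t) (1 - y ^ p) ^ u is t times y / (1 -
    y) - y ^ p / (1 - y ^ p), the sum of y ^ n over n prime to p in the sense of p not dividing
    n. *)
Lemma dilated_conv_rising_rec D p (t u : {poly rat}) M :
  (0 < p)%N -> (M < D)%N -> t = p%:R * u ->
  M%:R * dilated_conv D p (fun i => rising i t) (fun N => rising N (- u)) M =
  t * \sum_(m < M | ~~ (p %| M - m)%N)
        dilated_conv D p (fun i => rising i t) (fun N => rising N (- u)) m.
Proof.
move=> p0 ltM tE.
set f := fun i => rising i t; set g := fun N => rising N (- u).
have convE (Q : pred nat) : \sum_(m < M | Q m) dilated_conv D p f g m =
    \sum_(l < D) \sum_(N < D) if Q (l + p * N)%N &&
      (l + p * N < M)%N then f l * g N else 0.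
  rewrite /dilated_conv exchange_big /=; apply: eq_bigr => l _.
  under eq_bigr => m _ do rewrite big_mkcond /=.
  rewrite exchange_big /=; apply: eq_bigr => N _; rewrite -big_mkcondr /=.
  rewrite -(@sum_ord_eq _ M (fun m => Q m && (l + p * N == m)%N)) // => m _.
  by rewrite eq_sym; case: eqP => [->|]; rewrite ?andbF.
(* Writing M as i + p N distributes the derivative over the two series. *)
have -> : M%:R * dilated_conv D p f g M =
    \sum_(i < D) \sum_(N < D | (i + p * N == M)%N) (i%:R * f i) * g N +
    \sum_(i < D) \sum_(N < D | (i + p * N == M)%N) f i * (p%:R * (N%:R * g N)).
  rewrite /dilated_conv mulr_sumr -big_split; apply: eq_bigr => i _.
  rewrite mulr_sumr -big_split; apply: eq_bigr => N /eqP <- /=.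
  by rewrite natrD natrM; ring.
(* The series (1 - y) ^ (- t) contributes all m < M. *)
have -> : \sum_(i < D) \sum_(N < D | (i + p * N == M)%N) (i%:R * f i) * g N =
    t * \sum_(m < M) dilated_conv D p f g m.
  rewrite (convE xpredT) mulr_sumr.
  transitivity (\sum_(i < D) \sum_(N < D)
    \sum_(l < D | (l < i)%N && (i + p * N == M)%N)
      t * (f l * g N)).
    apply: eq_bigr => i _; rewrite [LHS]big_mkcond /=; apply: eq_bigr => N _.
    case: (i + p * N == M)%N; last by rewrite big_pred0 // => l; rewrite andbF.
    rewrite rising_sum -mulrA mulr_suml mulr_sumr
      (big_ord_widen D (fun l => t * (f l * g N))) 1?ltnW //.
    by apply: eq_bigl => l; rewrite andbT.
  under eq_bigr => i _ do (under eq_bigr => N _ do rewrite big_mkcond /=;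
    rewrite exchange_big /=).
  rewrite exchange_big /=; apply: eq_bigr => l _;
    rewrite exchange_big mulr_sumr /=.
  apply: eq_bigr => N _; rewrite -big_mkcond /=.
  rewrite (@sum_ord_eq _ D (fun i => (l < i)%N && (i + p * N == M)%N)
    (l + p * N < M)%N (M - p * N)%N).
    by case: ifP => h; case: ifP => h'; rewrite ?mulr0 //; lia.
  by move=> i _; lia.
(* Since t = p u, the series in y ^ p contributes with the opposite sign the m for which p divides M
   - m, and these cancel. *)
have -> : \sum_(i < D) \sum_(N < D | (i + p * N == M)%N) f i *
  (p%:R * (N%:R * g N)) =
    - t * \sum_(m < M | (p %| M - m)%N) dilated_conv D p f g m.
  rewrite (convE (fun m => p %| M - m)%N) mulr_sumr; apply: eq_bigr => i _.
  transitivity (\sum_(N < D) \sum_(l < D | (l < N)%N && (i + p * N == M)%N)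
      (- t) * (f i * g l)).
    rewrite [LHS]big_mkcond /=; apply: eq_bigr => N _.
    case: (i + p * N == M)%N; last by rewrite big_pred0 // => l; rewrite andbF.
    transitivity (\sum_(l < N) - t * (f i * g l)).
      by rewrite -!mulr_sumr /g rising_sum tE; ring.
    rewrite (big_ord_widen D (fun l => - t * (f i * g l))) 1?ltnW //.
    by apply: eq_bigl => l; rewrite andbT.
  under eq_bigr => N _ do rewrite big_mkcond /=.
  rewrite exchange_big mulr_sumr /=; apply: eq_bigr => l _;
    rewrite -big_mkcond /=.
  rewrite (@sum_ord_eq _ D (fun N => (l < N)%N && (i + p * N == M)%N)
     ((p %| M - (i + p * l)) && (i + p * l < M))%N ((M - i) %/ p)%N).
    case: ifP => h; case: ifP => h'; rewrite ?mulr0 //;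
      first by rewrite h' in h.
    move: h; rewrite h' /= => /negP[]; apply: leq_ltn_trans ltM.
    by apply: leq_trans (leq_div _ _) _; apply: leq_subr.
  move=> N _; apply/andP/andP => [[lN /eqP e]|[/andP[dv lt] /eqP ->]].
    have -> : (M - i = p * N)%N by lia.
    have -> : (M - (i + p * l) = p * (N - l))%N by nia.
    by rewrite mulKn // dvdn_mulr //; split=> //; nia.
  case/dvdnP: dv => e eE; have -> : (M - i = p * (l + e))%N by nia.
  by rewrite mulKn //; split; nia.
rewrite [\sum_(m < M) _](bigID (fun m : 'I_M => p %| M - m)%N) /=; ring.
Qed.

Lemma dilated_conv_rising0 D p (t u : {poly rat}) : (0 < p)%N -> (0 < D)%N ->
  dilated_conv D p (fun i => rising i t) (fun N => rising N (- u)) 0 = 1.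
Proof.
move=> p0; case: D => // D _;
  rewrite /dilated_conv big_ord_recl /= [X in _ + X]big1 ?addr0.
  rewrite (big_pred1 ord0) ?rising0 ?mulr1 // => i; apply/eqP/eqP => [|->];
    last by rewrite muln0.
  by move=> h; apply/val_inj => /=; move: h; case: (val i) => // n; nia.
by move=> i _; rewrite big_pred0.
Qed.

Lemma polyr_nat_neq0 n : (0 < n)%N -> n%:R != 0 :> {poly rat}.
Proof. by move=> n0; rewrite -polyC_natr polyC_eq0 pnatr_eq0 -lt0n. Qed.

(** This is the convolution for p = 1. As 1 divides every difference, the sum in the recurrence is
    empty, which kills all coefficients of positive index. *)
Lemma vandermonde0 x M : \sum_(i < M.+1) rising i x * rising (M - i) (- x) =
  (M == 0%N)%:R.
Proof.
have -> : \sum_(i < M.+1) rising i x * rising (M - i) (- x) =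
    dilated_conv M.+1 1 (fun i => rising i x) (fun N => rising N (- x)) M.
  apply: eq_bigr => i _.
  have ltMi : (M - i < M.+1)%N by rewrite ltnS leq_subr.
  rewrite (big_pred1 (Ordinal ltMi)) // => N; apply/eqP/eqP => [h|-> /=].
    by apply: val_inj => /=; lia.
  by have := ltn_ord i; lia.
case: M => [|M]; first by rewrite dilated_conv_rising0.
apply: (mulfI (polyr_nat_neq0 (ltn0Sn M)));
  rewrite (@dilated_conv_rising_rec _ _ x x) ?mul1r //.
by rewrite big_pred0 ?mulr0 // => m; rewrite dvd1n.
Qed.

(** The product of (1 - y) ^ (- x - c - 1) and (1 - y) ^ x no longer involves x. The proof lowers c
    by [rising_add1], which matches Pascal's rule. *)
Lemma vandermonde_shift x c M :
  \sum_(i < M.+1) rising i (x + c.+1%:R) * rising (M - i) (- x) =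
    'C(M + c, c)%:R.
Proof.
pose v c M := \sum_(i < M.+1) rising i (x + c%:R) * rising (M - i) (- x).
rewrite -/(v c.+1 M).
have vS d N : v d.+1 N.+1 = v d.+1 N + v d N.+1.
  rewrite /v [LHS]big_ord_recl [X in _ = _ + X]big_ord_recl /=
    !rising0 !mul1r addrCA; congr (_ + _).
  rewrite -big_split; apply: eq_bigr => i _ /=; rewrite /bump /= add1n subSS.
  by rewrite -natr1 addrA rising_add1 mulrDl.
have v0 d : v d 0%N = 1 by rewrite /v big_ord_recl big_ord0 !rising0 addr0
  mul1r.
have v0S N : v 0%N N.+1 = 0 by rewrite /v;
  under eq_bigr => i _ do rewrite addr0; rewrite vandermonde0.
elim: c M => [|c IHc]; elim=> [|M IHM];
  rewrite ?v0 ?add0n ?addn0 ?binn ?bin0 //.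
  by rewrite vS v0S addr0 IHM addn0 bin0.
by rewrite vS IHM IHc [(M.+1 + c.+1)%N]addSn binS natrD addSnnS.
Qed.

(** By [rising_bin] the factor x^(c) comes out of the sum; what remains is the coefficient of index
    P - c in (1 - y) ^ (- c), namely binom(P - 1, c - 1). *)
Lemma vandermonde_bin x P c : (0 < P)%N ->
  \sum_(N < P.+1) rising N x * rising (P - N) (- x) * 'C(N, c)%:R =
  (if c is c'.+1 then 'C(P.-1, c')%:R * rising c x else 0).
Proof.
move=> P0; case: c => [|c].
  under eq_bigr => N _ do rewrite bin0 mulr1.
  by rewrite vandermonde0 gtn_eqF.
have [ltcP|lePc] := ltnP c P; last first.
  rewrite bin_small ?prednK // mul0r big1 // => N _.
  by rewrite bin_small ?mulr0 //; have := ltn_ord N; lia.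
rewrite -(big_mkord xpredT (fun N =>
  rising N x * rising (P - N) (- x) * 'C(N, c.+1)%:R)).
rewrite (big_cat_nat (n := c.+1)) //=; last by rewrite leqW.
rewrite [X in X + _]big_nat_cond big1 ?add0r; last first.
  by move=> N /andP[/andP[_ ltN] _]; rewrite bin_small ?mulr0.
rewrite -{1}[c.+1]add0n big_addn big_mkord.
have -> : (P.+1 - c.+1 = (P - c.+1).+1)%N by lia.
transitivity (\sum_(i < (P - c.+1).+1) rising c.+1 x *
    (rising i (x + c.+1%:R) * rising (P - c.+1 - i) (- x))).
  apply: eq_bigr => i _.
  have := @rising_bin (i + c.+1) c.+1 x (leq_addl _ _); rewrite addnK => binE.
  have -> : (P - (i + c.+1) = P - c.+1 - i)%N by lia.
  by rewrite [RHS]mulrA -binE; ring.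
rewrite -mulr_sumr vandermonde_shift mulrC; congr ('C(_, _)%:R * _); lia.
Qed.

(** The polynomial variable stands for y here, but for t wherever it is an argument of [rising].
    Terms of degree above D cannot reach the coefficients up to y ^ D. *)
Definition logp (p D : nat) : {poly rat} :=
  \poly_(n < D.+1) (if (p %| n)%N then 0 else n%:R^-1).

(** As p is prime, the condition on the product of the n_i is a condition on each of them, and it
    forces them to be positive; multiplying out the power then gives the sum term by term. *)
Lemma Csum_coef r k p : prime p -> Csum r k p = (logp p (p ^ r) ^+ k)`_(p ^ r).
Proof.
move=> pr; set D := (p ^ r)%N.
have -> : logp p D ^+ k = \prod_(i < k) logp p D
  by rewrite prodr_const card_ord.
rewrite /logp.
under eq_bigr => i _ do rewrite poly_def.
rewrite bigA_distr_bigA /= coef_sum /Csum -/D.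
rewrite [LHS]big_mkcond; apply: eq_bigr => n _.
have -> : \prod_(i < k) ((if (p %| n i)%N then 0 else (n i)%:R^-1) *: 'X^(n i))
  =
    (\prod_(i < k) (if (p %| n i)%N then 0 else (n i)%:R^-1)) *:
      'X^(\sum_(i < k) n i) :> {poly rat}.
  by rewrite scaler_prod; congr (_ *: _); rewrite -expr_sum.
rewrite coefZ coefXn eq_sym.
have [dv|ndv] := boolP (p %| \prod_(i < k) n i)%N.
  rewrite !andbF; have [i pi] : exists i, (p %| n i)%N.
    apply/existsP; apply: contraLR dv; rewrite negb_exists => /forallP h.
    by elim/big_ind: _ => [|a b ha hb|i _];
      [rewrite Euclid_dvd1|rewrite Euclid_dvdM // negb_or ha|].
  by rewrite (bigD1 i) //= pi !mul0r.
have ni i : (p %| n i)%N = false.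
  by apply/negP => h; move/negP: ndv; apply; rewrite (bigD1 i) //= dvdn_mulr.
have -> : [forall i, (0 < n i)%N].
  by apply/forallP => i; rewrite lt0n; apply/eqP => h; have := ni i;
    rewrite h dvdn0.
rewrite andbT /=; case: eqP => _; rewrite ?mulr0 // mulr1 -prodfV.
by apply: eq_bigr => i _; rewrite ni.
Qed.

(** This replaces the expansion of exp (t L) in powers of t, with L = [logp p D]. The derivative (k
    + 1) L ^ k L' of L ^ (k + 1) yields the recurrence that the convolution satisfies, because L'
    has coefficient 1 at y ^ (n - 1) if p does not divide n, and 0 otherwise. *)
Lemma coef_logp_exp p D k M (u : {poly rat}) : (0 < p)%N -> (M <= D)%N ->
  'X = p%:R * u ->
  (logp p D ^+ k)`_M =
  k`!%:R * (dilated_conv D.+1 p (fun i => rising i 'X)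
    (fun N => rising N (- u)) M)`_k.
Proof.
move=> p0 leMD tE; set y := dilated_conv _ _ _ _.
have y0 : y 0%N = 1 by rewrite /y dilated_conv_rising0.
have yrec m j : (m <= D)%N -> m%:R * (y m)`_j =
    if j is j'.+1 then \sum_(i < m | ~~ (p %| m - i)%N) (y i)`_j' else 0.
  move=> lem; have := dilated_conv_rising_rec p0 (lem : (m < D.+1)%N) tE;
    rewrite -/y.
  move/(congr1 (fun q : {poly rat} => q`_j)); rewrite -polyC_natr coefCM => ->.
  by rewrite coefXM; case: j => //= j; rewrite coef_sum.
have A0 : (logp p D)`_0 = 0 by rewrite coef_poly dvdn0.
elim: k M leMD => [|k IHk] M leMD.
  rewrite expr0 coef1 mul1r; case: M leMD => [|M] leMD;
    first by rewrite y0 coef1.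
  have /eqP := yrec M.+1 0%N leMD; rewrite mulf_eq0 pnatr_eq0 /= => /eqP ->.
  by [].
case: M leMD => [|M] leMD.
  by rewrite y0 coef1 mulr0 exprS coef0M A0 mul0r.
have n0 : M.+1%:R != 0 :> rat by rewrite pnatr_eq0.
apply: (mulfI n0); rewrite mulrCA yrec //.
have : ((logp p D ^+ k.+1)^`())`_M = M.+1%:R * (logp p D ^+ k.+1)`_M.+1.
  by rewrite coef_deriv mulr_natl.
move=> <-; rewrite deriv_exp /=
  coefMn coefM factS natrM -mulrA -[LHS]mulr_natl; congr (_ * _).
rewrite mulr_sumr [RHS]big_mkcond /= (reindex_inj rev_ord_inj) /=.
apply: eq_bigr => i _; have lti := ltn_ord i.
rewrite coef_deriv coef_poly subSS.
have -> : ((M - i).+1 = M.+1 - i)%N by lia.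
have -> : (M - (M - i) = i)%N by lia.
rewrite ltnS (leq_trans (leq_subr _ _) leMD) IHk ?(leq_trans _ leMD) 1?ltnW //.
by case: ifP => dv /=; rewrite ?mul0rn ?mulr0 ?mul0r // -[_^-1 *+ _]mulr_natr
  mulVf ?mul1r // pnatr_eq0; lia.
Qed.

(** * Splitting off the multiples of p *)

Definition Wprod (p : nat) (f : nat -> nat -> rat) (N : nat) : {poly rat} :=
  \prod_(j < N) \prod_(a < p.-1) (1 + f a.+1 j *: 'X).

Definition inv_ap (p a j : nat) : rat := (a + p * j)%:R^-1.

Definition uX (p : nat) : {poly rat} := p%:R^-1 *: 'X.

Lemma rising_addn M m x :
  rising (M + m) x = rising M x * \prod_(n < m)
    ((M + n).+1%:R^-1 *: (x + (M + n)%:R)).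
Proof.
elim: m => [|m IH]; first by rewrite big_ord0 mulr1 addn0.
rewrite addnS risingS IH big_ord_recr /=;
  move: (rising M x) (\prod_(i < m) _) => q1 q2.
by rewrite -!scalerAr; congr (_ *: _); ring.
Qed.

Lemma rising_mulp p N : (0 < p)%N ->
  rising (p * N) 'X = rising N (uX p) * Wprod p (inv_ap p) N.
Proof.
case: p => // p _; elim: N => [|N IH];
  first by rewrite muln0 !rising0 /Wprod big_ord0 mulr1.
have -> : (p.+1 * N.+1 = p.+1 * N + p.+1)%N by rewrite mulnS addnC.
rewrite rising_addn IH /Wprod [\prod_(j < N.+1) _]big_ord_recr /=.
set W := \prod_(j < N) _; rewrite risingS.
suff -> : \prod_(n < p.+1) ((p.+1 * N + n).+1%:R^-1 *:
  ('X + (p.+1 * N + n)%:R)) =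
    N.+1%:R^-1 *: ((uX p.+1 + N%:R) * \prod_(a < p)
      (1 + inv_ap p.+1 a.+1 N *: 'X)).
  move: (rising N _) (\prod_(a < p) _) => q1 q2.
  by rewrite -!scalerAl -!scalerAr; congr (_ *: _); ring.
(* The multiple of the prime comes first among the numerators, in t + p N, but last among the
   denominators, as p (N + 1). The other factors pair up after a shift by one. *)
rewrite scaler_prod big_ord_recr /= [\prod_(n < p.+1) (_ + _)]big_ord_recl /=
  addn0.
have -> : \prod_(a < p) (1 + inv_ap p.+1 a.+1 N *: 'X) =
    (\prod_(a < p) (p.+1 * N + a).+1%:R^-1) *:
    \prod_(a < p) ('X + (p.+1 * N + bump 0 a)%:R) :> {poly rat}.
  rewrite -scaler_prod; apply: eq_bigr => a _; rewrite /inv_ap /bump /= add1n.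
  have -> : (a.+1 + p.+1 * N = (p.+1 * N + a).+1)%N by lia.
  rewrite addnS scalerDr addrC; congr (_ + _).
  by rewrite -polyC_natr -mul_polyC -polyCM mulVf ?pnatr_eq0.
have -> : uX p.+1 + N%:R = p.+1%:R^-1 *: ('X + (p.+1 * N)%:R).
  rewrite /uX scalerDr; congr (_ + _).
  by rewrite -!polyC_natr -mul_polyC -polyCM natrM mulKf // pnatr_eq0.
rewrite -scalerAl -!scalerAr !scalerA; congr (_ *: _).
have -> : ((p.+1 * N + p).+1 = p.+1 * N.+1)%N by rewrite mulnS; lia.
by rewrite natrM invfM; ring.
Qed.

Definition Wsum (p P : nat) (W : nat -> {poly rat}) : {poly rat} :=
  \sum_(N < P.+1) rising N (uX p) * rising (P - N) (- uX p) * W N.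

Lemma Csum_Wsum r k p : prime p ->
  Csum r.+1 k p = k`!%:R * (Wsum p (p ^ r) (Wprod p (inv_ap p)))`_k.
Proof.
move=> pr; have p0 := prime_gt0 pr.
have uE : 'X = p%:R * uX p.
  by rewrite /uX -polyC_natr mul_polyC scalerA mulfV ?scale1r // pnatr_eq0
    -lt0n.
rewrite Csum_coef // (coef_logp_exp _ p0 (leqnn _) uE); congr (_ * _`_k);
  congr polyseq.
set M := (p ^ r.+1)%N; set P := (p ^ r)%N.
have ME : M = (p * P)%N by rewrite /M expnS.
have leP : (P <= M)%N by rewrite ME leq_pmull.
rewrite /dilated_conv (exchange_big_dep xpredT) //=.
(* As the exponent is p P, the condition i + p N = p P leaves the single index i = p (P - N). *)
transitivity (\sum_(N < P.+1) rising (p * (P - N)) 'X * rising N (- uX p)).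
  rewrite (big_ord_widen M.+1 (fun N =>
    rising (p * (P - N)) 'X * rising N (- uX p))) ?ltnS //.
  rewrite [RHS]big_mkcond; apply: eq_bigr => N _.
  have [leN|ltN] := leqP N P; last
    by rewrite ltnS leqNgt ltN big_pred0 // => i; nia.
  have ltM : (p * (P - N) < M.+1)%N by move: ME; nia.
  rewrite ltnS leN (big_pred1 (Ordinal ltM)) // => i.
  move: ME => ME'; apply/eqP/eqP => [h|->] /=; [apply: val_inj => /=|]; nia.
rewrite (reindex_inj rev_ord_inj) /Wsum; apply: eq_bigr => N _ /=;
  rewrite subSS.
have leN : (N <= P)%N by rewrite -ltnS.
by rewrite subKn // rising_mulp //; ring.
Qed.

(** * Finite differences *)

Definition fdiff (f : nat -> rat) (N : nat) : rat := f N.+1 - f N.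

Lemma eq_iter_fdiff f g c : f =1 g -> iter c fdiff f =1 iter c fdiff g.
Proof. by move=> fg; elim: c => //= c IH N; rewrite /fdiff !IH. Qed.

Lemma iter_fdiff_bin f c N :
  iter c fdiff f N = \sum_(i < c.+1) (-1) ^+ (c - i) * 'C(c, i)%:R * f
    (N + i)%N.
Proof.
elim: c N => [|c IH] N; first
  by rewrite /= big_ord_recl big_ord0 addr0 addn0 !mul1r.
rewrite /= /fdiff !IH.
have -> : \sum_(i < c.+2) (-1) ^+ (c.+1 - i) * 'C(c.+1, i)%:R * f (N + i)%N =
   \sum_(i < c.+2) (-1) ^+ (c.+1 - i) * 'C(c, i)%:R * f (N + i)%N +
   \sum_(i < c.+1) (-1) ^+ (c - i) * 'C(c, i)%:R * f (N.+1 + i)%N.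
  rewrite big_ord_recl [in RHS]big_ord_recl /= !bin0 -addrA; congr (_ + _).
  rewrite -big_split; apply: eq_bigr => i _;
    rewrite /= /bump /= add1n subSS binS natrD.
  by rewrite addSnnS; ring.
rewrite [X in _ = X + _]big_ord_recr /= bin_small // mulr0 mul0r addr0 addrC;
  congr (_ + _).
rewrite -sumrN; apply: eq_bigr => i _; rewrite subSn; last by rewrite -ltnS.
by rewrite exprS; ring.
Qed.

(** Being a polynomial of degree at most K in N, expressed by differences so that no polynomial has
    to be exhibited. *)
Definition fdeg (K : nat) (f : nat -> rat) := forall N, iter K.+1 fdiff f N = 0.

Lemma fdeg_ext K f g : f =1 g -> fdeg K f -> fdeg K g.
Proof. by move=> fg df N; rewrite -(eq_iter_fdiff _ fg) df. Qed.

Lemma iter_fdiff0 c f : (forall N, f N = 0) -> forall N, iter c fdiff f N = 0.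
Proof. by move=> f0; elim: c => //= c IH N; rewrite /fdiff !IH subr0. Qed.

Lemma fdeg_leq K L f : (K <= L)%N -> fdeg K f -> fdeg L f.
Proof.
move=> leKL df N; rewrite -(subnK (leKL : K.+1 <= L.+1)%N) iterD.
exact: iter_fdiff0.
Qed.

Lemma iter_fdiffD c f g N : iter c fdiff (fun N => f N + g N) N =
  iter c fdiff f N + iter c fdiff g N.
Proof. by elim: c N => //= c IH N; rewrite /fdiff !IH; ring. Qed.

Lemma iter_fdiffZ c x f N : iter c fdiff (fun N => x * f N) N =
  x * iter c fdiff f N.
Proof. by elim: c N => //= c IH N; rewrite /fdiff !IH; ring. Qed.

Lemma iter_fdiff_shift c f N :
  iter c fdiff (fun N => f N.+1) N = iter c fdiff f N.+1.
Proof. by elim: c N => //= c IH N; rewrite /fdiff !IH. Qed.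

Lemma fdeg_add K f g : fdeg K f -> fdeg K g -> fdeg K (fun N => f N + g N).
Proof. by move=> df dgg N; rewrite iter_fdiffD df dgg addr0. Qed.

Lemma fdegZ K x f : fdeg K f -> fdeg K (fun N => x * f N).
Proof. by move=> df N; rewrite iter_fdiffZ df mulr0. Qed.

Lemma fdeg_fdiff K f : fdeg K (fdiff f) -> fdeg K.+1 f.
Proof. by move=> df N; rewrite iterSr df. Qed.

Lemma fdeg_const f : fdeg 0 f -> forall N, f N = f 0%N.
Proof. by move=> df; elim=> // N <-; apply/eqP; rewrite -subr_eq0;
  apply/eqP/(df N). Qed.

Lemma fdeg_cst x K : fdeg K (fun=> x).
Proof. by apply: (fdeg_leq (leq0n K)) => N; rewrite /= /fdiff subrr. Qed.

(** The difference of f g is (fdiff f)(N) g(N + 1) + f(N) (fdiff g)(N), so induction on K + L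
    applies to both summands. *)
Lemma fdeg_mul K L f g : fdeg K f -> fdeg L g ->
  fdeg (K + L) (fun N => f N * g N).
Proof.
move: {2}(K + L)%N (leqnn (K + L)) => n.
elim: n K L f g => [|n IH] K L f g.
  case: K => [|K]; case: L => [|L] // _ df dgg;
    apply: (@fdeg_ext _ (fun=> f 0%N * g 0%N)); last exact: fdeg_cst.
  by move=> N; rewrite (fdeg_const df) (fdeg_const dgg).
case: K => [|K].
  move=> _ df dgg; apply: (@fdeg_ext _ (fun N => f 0%N * g N));
    last exact: fdegZ.
  by move=> N; rewrite (fdeg_const df N).
case: L => [|L] le_n df dgg.
  rewrite addn0; apply: (@fdeg_ext _ (fun N => g 0%N * f N)); last exact: fdegZ.
  by move=> N; rewrite (fdeg_const dgg N) mulrC.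
rewrite addSn; apply: fdeg_fdiff.
apply: (@fdeg_ext _ (fun N => fdiff f N * g N.+1 + f N * fdiff g N)).
  by move=> N; rewrite /fdiff; ring.
apply: fdeg_add.
  apply: IH; first by lia.
    by move=> N; rewrite -iterSr df.
  by move=> N; rewrite iter_fdiff_shift dgg.
rewrite -addSnnS; apply: IH => //; first by lia.
by move=> N; rewrite -iterSr dgg.
Qed.

Lemma fdeg_sum K n (F : nat -> nat -> rat) :
  (forall i, (i < n)%N -> fdeg K (F i)) ->
  fdeg K (fun N => \sum_(i < n) F i N).
Proof.
elim: n => [|n IH] dF.
  by apply: (@fdeg_ext _ (fun=> 0)) => [N|]; [rewrite big_ord0|apply: fdeg_cst].
apply: (@fdeg_ext _ (fun N => \sum_(i < n) F i N + F n N)).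
  by move=> N; rewrite big_ord_recr.
by apply: fdeg_add; [apply: IH => i lt; apply: dF; apply: leqW|apply: dF].
Qed.

Lemma newton K f N : fdeg K f ->
  f N = \sum_(c < K.+1) 'C(N, c)%:R * iter c fdiff f 0.
Proof.
elim: N f => [|N IH] f df.
  rewrite big_ord_recl /= mul1r big1 ?addr0 // => i _.
  by rewrite bin0n mul0r.
have -> : f N.+1 = f N + fdiff f N by rewrite /fdiff; ring.
rewrite (IH f df) (IH (fdiff f)); last first.
  by apply: (fdeg_leq (leqnn K)) => M;
    rewrite -iterSr -[RHS](iter_fdiff0 1 df M).
rewrite [LHS]addrC [\sum_(c < K.+1) 'C(N, c)%:R * iter c fdiff
  (fdiff f) 0]big_ord_recr /=.
have -> : iter K fdiff (fdiff f) 0 = 0 by rewrite -iterSr df.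
rewrite mulr0 addr0 addrC big_ord_recl [RHS]big_ord_recl /= !bin0 -addrA;
  congr (_ + _).
rewrite -big_split; apply: eq_bigr => i _.
by rewrite /= /bump /= add1n binS natrD mulrDl
  -[fdiff (iter i fdiff f) 0]/(iter i.+1 fdiff f 0) iterSr.
Qed.

Definition newton_delta (c : nat) (W : nat -> {poly rat}) : {poly rat} :=
  \sum_(i < c.+1) ((-1) ^+ (c - i) * 'C(c, i)%:R) *: W i.

(** Here the sum over N, whose length depends on p, is exchanged for one with a fixed number K of
    terms. *)
Lemma Wsum_newton p P k K (W : nat -> {poly rat}) : (0 < P)%N ->
  (forall m, (m <= k)%N -> fdeg K (fun N => (W N)`_m)) ->
  (Wsum p P W)`_k =
  (\sum_(c < K) 'C(P.-1, c)%:R * rising c.+1 (uX p) * newton_delta c.+1 W)`_k.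
Proof.
move=> P0 dW.
have dE c m : (newton_delta c W)`_m = iter c fdiff (fun N => (W N)`_m) 0.
  rewrite iter_fdiff_bin coef_sum; apply: eq_bigr => i _.
  by rewrite coefZ add0n.
rewrite /Wsum coef_sum.
transitivity (\sum_(N < P.+1) \sum_(m < k.+1) \sum_(c < K.+1)
   (rising N (uX p) * rising (P - N) (- uX p) * 'C(N, c)%:R)`_m *
     (newton_delta c W)`_(k - m)).
  apply: eq_bigr => N _; rewrite coefM; apply: eq_bigr => m _.
  rewrite (newton N (dW (k - m)%N (leq_subr _ _))) mulr_sumr;
    apply: eq_bigr => c _.
  by rewrite -polyC_natr coefMC -mulrA dE.
transitivity (\sum_(m < k.+1) \sum_(c < K.+1)
   (\sum_(N < P.+1) rising N (uX p) * rising (P - N) (- uX p) * 'C(N, c)%:R)`_m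
     * (newton_delta c W)`_(k - m)).
  rewrite exchange_big; apply: eq_bigr => m _; rewrite exchange_big;
    apply: eq_bigr => c _.
  by move: (_`_(k - m)) => x; rewrite coef_sum mulr_suml.
(* The difference of order 0 drops out by [vandermonde_bin], which shifts the index c by one. *)
rewrite coef_sum exchange_big /= big_ord_recl /= big1 ?add0r; last first.
  by move=> m _; rewrite vandermonde_bin // coef0 mul0r.
apply: eq_bigr => c _; rewrite coefM; apply: eq_bigr => m _.
by rewrite vandermonde_bin.
Qed.

Lemma coef0_lin_prod (I : Type) (s : seq I) (f : I -> rat) :
  (\prod_(a <- s) (1 + f a *: 'X))`_0 = 1 :> rat.
Proof.
elim: s => [|a s IH]; first by rewrite big_nil coef1.
by rewrite big_cons coef0M IH coefD coef1 coefZ coefX mulr0 addr0 mulr1.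
Qed.

(** The coefficient is the elementary symmetric polynomial of degree m in the f a j. The bound is
    free of the number n of factors, which will be p - 1. *)
Lemma fdeg_lin_prod E n (f : nat -> nat -> rat) m : (forall a, fdeg E (f a)) ->
  fdeg (m * E) (fun j => (\prod_(a < n) (1 + f a j *: 'X))`_m : rat).
Proof.
move=> df; elim: n m => [|n IH] m.
  by apply: (@fdeg_ext _ (fun=> (1 : {poly rat})`_m)) => [j|];
    [rewrite big_ord0|apply: fdeg_cst].
apply: (@fdeg_ext _ (fun j => (\prod_(a < n) (1 + f a j *: 'X))`_m +
    f n j * (if m is m'.+1 then (\prod_(a < n) (1 + f a j *: 'X))`_m' else 0))).
  move=> j; rewrite big_ord_recr /=; set q := \prod_(_ < n) _.
  rewrite mulrDr mulr1 coefD -scalerAr coefZ coefMX.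
  by case: m.
apply: fdeg_add => //; case: m => [|m]; last by rewrite mulSn; apply: fdeg_mul.
by apply: (@fdeg_ext _ (fun=> 0)) => [j|]; [rewrite mulr0|apply: fdeg_cst].
Qed.

(** Passing from N to N + 1 multiplies by a polynomial with constant term 1, so the difference of
    the m-th coefficient involves only the coefficients l < m. Each summand has degree at most l (E
    + 1) + (m - l) E, which is less than m (E + 1). *)
Lemma fdeg_Wprod p E (f : nat -> nat -> rat) m : (forall a, fdeg E (f a)) ->
  fdeg (m * E.+1) (fun N => (Wprod p f N)`_m).
Proof.
move=> df; elim/ltn_ind: m => m IH.
pose Q j := \prod_(a < p.-1) (1 + f a.+1 j *: 'X) : {poly rat}.
have WS N : Wprod p f N.+1 = Wprod p f N * Q N by rewrite /Wprod big_ord_recr.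
have Q0 N : (Q N)`_0 = 1 by apply: coef0_lin_prod.
have dQ l : fdeg (l * E) (fun j => (Q j)`_l) by apply:
  (@fdeg_lin_prod E p.-1 (fun a => f a.+1)).
have difE N : fdiff (fun N => (Wprod p f N)`_m) N =
    \sum_(l < m) (Wprod p f N)`_l * (Q N)`_(m - l).
  by rewrite /fdiff WS coefM big_ord_recr /= subnn Q0 mulr1 addrK.
case: m IH difE => [|m] IH difE.
  by move=> N /=; rewrite difE big_ord0.
rewrite mulSn addSn; apply: fdeg_fdiff;
  apply: (@fdeg_ext _ (fun N =>
  \sum_(l < m.+1) (Wprod p f N)`_l * (Q N)`_(m.+1 - l))).
  by move=> N; rewrite difE.
apply: (fdeg_sum (F := fun l N => (Wprod p f N)`_l * (Q N)`_(m.+1 - l))) =>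
  l ltl.
apply: (fdeg_leq _ (fdeg_mul (IH l ltl) (dQ (m.+1 - l)%N))).
by rewrite mulnS -addnA -mulnDl subnKC ?(ltnW ltl) // mulSn mulnS addnCA
  leq_add2l leq_add2r.
Qed.

Definition trunc_inv (p E a j : nat) : rat :=
  \sum_(b < E) (-1 * j%:R) ^+ b * p%:R ^+ b / a%:R ^+ b.+1.

Lemma fdeg_exp x b : fdeg b (fun j => (x * j%:R) ^+ b).
Proof.
elim: b => [|b IH]; first exact: fdeg_cst.
apply: (@fdeg_ext _ (fun j => (x * j%:R) * (x * j%:R) ^+ b)) => [j|];
  first by rewrite exprS.
rewrite -add1n; apply: fdeg_mul => // N /=; rewrite /fdiff -!natr1; ring.
Qed.

Lemma fdeg_trunc_inv p E a : fdeg E (trunc_inv p E.+1 a).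
Proof.
apply: (fdeg_sum (F := fun b j => (-1 * j%:R) ^+ b * p%:R ^+ b / a%:R ^+ b.+1))
  => b ltb.
apply: (@fdeg_ext _ (fun j => (p%:R ^+ b / a%:R ^+ b.+1) * (-1 * j%:R) ^+ b))
  => [j|].
  by ring.
by apply: fdegZ; apply: (fdeg_leq (ltb : (b <= E)%N)); apply: fdeg_exp.
Qed.

(** * Integrality at p *)

(** For prime p, membership in the local ring Z_(p). *)
Definition pint (p : nat) (x : rat) : Prop :=
  exists (a : int) (b : nat), ~~ (p %| b)%N /\ x = a%:~R / b%:R.

Lemma pint_int p (a : int) : prime p -> pint p a%:~R.
Proof. by move=> pr; exists a, 1%N;
  rewrite dvdn1 gtn_eqF ?prime_gt1 ?divr1. Qed.

Lemma pint_nat p (a : nat) : prime p -> pint p a%:R.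
Proof. by move=> pr; apply: (pint_int a pr). Qed.

Lemma ndvd_neq0 p b : ~~ (p %| b)%N -> b%:R != 0 :> rat.
Proof. by rewrite pnatr_eq0; apply: contra => /eqP ->; rewrite dvdn0. Qed.

Lemma pint_inv p n : ~~ (p %| n)%N -> pint p n%:R^-1.
Proof. by move=> pn; exists 1, n; rewrite div1r. Qed.

Lemma pintM p x y : prime p -> pint p x -> pint p y -> pint p (x * y).
Proof.
move=> pr [a [b [pb ->]]] [c [d [pd ->]]]; exists (a * c), (b * d)%N.
by rewrite Euclid_dvdM // negb_or pb pd mulf_div intrM natrM.
Qed.

Lemma pintD p x y : prime p -> pint p x -> pint p y -> pint p (x + y).
Proof.
move=> pr [a [b [pb ->]]] [c [d [pd ->]]];
  exists (a * d%:Z + c * b%:Z), (b * d)%N.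
rewrite Euclid_dvdM // negb_or pb pd addf_div ?(ndvd_neq0 pb) ?(ndvd_neq0 pd)
  //.
by rewrite intrD !intrM natrM.
Qed.

Lemma pintX p x n : prime p -> pint p x -> pint p (x ^+ n).
Proof. by move=> pr px; elim: n => [|n IH];
  [apply: (pint_nat 1 pr) | rewrite exprS; apply: pintM]. Qed.

Lemma pint_sum p n (F : 'I_n -> rat) : prime p ->
  (forall i, pint p (F i)) -> pint p (\sum_(i < n) F i).
Proof.
move=> pr pF; elim/big_ind: _ => // [|x y]; first exact: (pint_nat 0 pr).
exact: pintD.
Qed.

Lemma pint_dvd p n x y : prime p -> pint p ((x - y) / p%:R ^+ n) ->
  rat_congr (p ^ n) x y.
Proof.
move=> pr [a [b [pb xE]]]; rewrite /rat_congr.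
have p0 : p%:R ^+ n != 0 :> rat
  by rewrite expf_neq0 // pnatr_eq0 -lt0n prime_gt0.
have b0 := ndvd_neq0 pb.
set z := x - y in xE *.
have zE : numq z * b%:Z = (p ^ n)%N%:Z * a * denq z.
  apply: (@intr_inj rat); rewrite !intrM.
  have -> : (numq z)%:~R = z * (denq z)%:~R :> rat by rewrite numqE.
  have -> : z = a%:~R / b%:R * p%:R ^+ n by rewrite -xE divfK.
  by rewrite -[(b%:Z)%:~R]/(b%:R) -[((p ^ n)%N%:Z)%:~R]/((p ^ n)%:R) natrX;
    field.
have : ((p ^ n)%N%:Z %| numq z * b%:Z)%Z by rewrite zE -mulrA dvdz_mulr.
rewrite Gauss_dvdzl //; rewrite /coprimez /gcdz /= eqz_nat -/(coprime _ _).
by rewrite coprimeXl // prime_coprime.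
Qed.

(* q(p ^ r * X) has all its coefficients in p ^ E * Z_(p). *)
Definition scaled_pint (p r E : nat) (q : {poly rat}) : Prop :=
  forall i, pint p ((p%:R ^+ r) ^+ i * q`_i / p%:R ^+ E).

Lemma scaled_pintM p r E q1 q2 : prime p -> scaled_pint p r 0 q1 ->
  scaled_pint p r E q2 -> scaled_pint p r E (q1 * q2).
Proof.
move=> pr i1 i2 k; rewrite coefM mulr_sumr mulr_suml; apply: pint_sum => // i.
have -> : (p%:R ^+ r) ^+ k * (q1`_i * q2`_(k - i)) / p%:R ^+ E =
   ((p%:R ^+ r) ^+ i * q1`_i / p%:R ^+ 0) *
     ((p%:R ^+ r) ^+ (k - i) * q2`_(k - i) / p%:R ^+ E) :> rat.
  have le_ik : (i <= k)%N by rewrite -ltnS.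
  by rewrite -{1}(subnKC le_ik) exprD expr0 divr1; ring.
exact: pintM.
Qed.

Lemma scaled_pintD p r E q1 q2 : prime p -> scaled_pint p r E q1 ->
  scaled_pint p r E q2 -> scaled_pint p r E (q1 + q2).
Proof. by move=> pr i1 i2 k; rewrite coefD mulrDr mulrDl; apply: pintD. Qed.

Lemma scaled_pint0 p r E : prime p -> scaled_pint p r E 0.
Proof. by move=> pr k; rewrite coef0 mulr0 mul0r; apply: (pint_nat 0 pr). Qed.

Lemma scaled_pint_sum p r E n (F : 'I_n -> {poly rat}) : prime p ->
  (forall i, scaled_pint p r E (F i)) -> scaled_pint p r E (\sum_(i < n) F i).
Proof.
move=> pr iF; elim/big_ind: _ => // [|x y];
  [exact: scaled_pint0 | exact: scaled_pintD].
Qed.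

Lemma scaled_pint1 p r : prime p -> scaled_pint p r 0 1.
Proof.
move=> pr k; rewrite coef1 expr0 divr1; case: k => [|k].
  by rewrite expr0 mul1r; apply: (pint_nat 1 pr).
by rewrite mulr0; apply: (pint_nat 0 pr).
Qed.

Lemma scaled_pintZX p r E c : prime p -> pint p (p%:R ^+ r * c / p%:R ^+ E) ->
  scaled_pint p r E (c *: 'X).
Proof.
move=> pr ic k; rewrite coefZ coefX; case: (k == 1%N) / eqP => [->|_].
  by rewrite expr1 mulr1.
by rewrite !mulr0 mul0r; apply: (pint_nat 0 pr).
Qed.

(** The power of p dividing n is at most n, hence at most p ^ s. *)
Lemma pint_ppow p s n : prime p -> (0 < n)%N -> (n <= p ^ s)%N ->
  pint p (p%:R ^+ s / n%:R).
Proof.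
move=> pr n0 len.
have [m pm nE] := pfactor_coprime pr n0.
have ndv : ~~ (p %| m)%N by rewrite -prime_coprime.
have les : (logn p n <= s)%N.
  rewrite -(leq_exp2l _ _ (prime_gt1 pr)); apply: leq_trans len.
  by apply: dvdn_leq => //; apply: pfactor_dvdnn.
have p0 : p%:R != 0 :> rat by rewrite pnatr_eq0 -lt0n prime_gt0.
exists (p ^ (s - logn p n))%N%:Z, m; split=> //.
rewrite [in LHS]nE natrM !natrX -[in LHS](subnK les) exprD
  -[X in _ = X / _]/((p ^ _)%:R) natrX.
by field; rewrite (ndvd_neq0 ndv) expf_neq0.
Qed.

(** Distributing the factorial over the factors leaves one denominator in each, so that integrality
    can be checked factor by factor. *)
Lemma rising_alt N x : rising N.+1 x = N.+1%:R^-1 *: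
  x * \prod_(n < N) (1 + n.+1%:R^-1 *: x).
Proof.
elim: N => [|N IH]; first by rewrite risingS rising0 big_ord0 !mulr1 addr0.
rewrite risingS IH big_ord_recr /=; move: (\prod_(_ < N) _) => q.
have -> : x + N.+1%:R = N.+1%:R * (1 + N.+1%:R^-1 *: x).
  rewrite mulrDr mulr1 addrC -polyC_natr mul_polyC scalerA mulfV ?scale1r //.
  by rewrite pnatr_eq0.
rewrite -!scalerAl; congr (_ *: _); rewrite -scalerAr -!polyC_natr.
rewrite -mulrA mul_polyC scalerA mulVf ?pnatr_eq0 // scale1r; ring.
Qed.

(** Replacing t by p ^ (r + 1) t turns t / (p n) into p ^ r t / n, which is integral for n <= p ^ r.
    The sign covers both arguments occurring in [Wsum]. *)
Lemma scaled_pint_rising p r N (e : bool) : prime p -> (N <= p ^ r)%N ->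
  scaled_pint p r.+1 0 (rising N ((-1) ^+ e *: uX p)).
Proof.
move=> pr; case: N => [|N] leN; first by rewrite rising0; apply: scaled_pint1.
have H n : (n <= N)%N -> scaled_pint p r.+1 0
  (n.+1%:R^-1 *: ((-1) ^+ e *: uX p)).
  move=> len; rewrite /uX !scalerA; apply: scaled_pintZX => //.
  have -> : p%:R ^+ r.+1 * (n.+1%:R^-1 * (-1) ^+ e / p%:R) / p%:R ^+ 0 =
     (-1) ^+ e * (p%:R ^+ r / n.+1%:R) :> rat.
    by rewrite expr0 exprS; field;
      rewrite nat1r !pnatr_eq0 -!lt0n (prime_gt0 pr).
  apply: pintM => //; first by apply: pintX => //; apply: (pint_int (-1) pr).
  by apply: pint_ppow => //; apply: leq_trans leN.
rewrite rising_alt; apply: scaled_pintM => //; first exact: H.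
elim/big_ind: _ => [|x y|i _]; [exact: scaled_pint1 | exact: scaled_pintM |].
by apply: scaled_pintD => //; [apply: scaled_pint1|apply: H; apply: ltnW].
Qed.

Lemma inv_trunc_diff p E a j : prime p -> (0 < a < p)%N ->
  pint p ((inv_ap p a j - trunc_inv p E a j) / p%:R ^+ E).
Proof.
move=> pr /andP[a0 ltap].
have pa : ~~ (p %| a)%N by rewrite gtnNdvd.
have paj : ~~ (p %| a + p * j)%N by rewrite dvdn_addl // dvdn_mulr.
have a0' := ndvd_neq0 pa; have aj0 := ndvd_neq0 paj.
have p0 : p%:R != 0 :> rat by rewrite pnatr_eq0 -lt0n prime_gt0.
(* The exact remainder of the geometric series in - p j / a. *)
have -> : inv_ap p a j - trunc_inv p E a j =
    (-1 * j%:R) ^+ E * p%:R ^+ E / a%:R ^+ E / (a + p * j)%:R.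
  rewrite /inv_ap /trunc_inv; elim: E => [|E IH].
    by rewrite big_ord0 subr0 !expr0 !(mul1r, divr1).
  rewrite big_ord_recr /= opprD addrA IH !exprS.
  have -> : (a + p * j)%:R = a%:R + p%:R * j%:R :> rat by rewrite natrD natrM.
  have e0 : a%:R ^+ E != 0 :> rat by rewrite expf_neq0.
  by field; rewrite a0' e0 -natrM -natrD aj0.
have -> : (-1 * j%:R) ^+ E * p%:R ^+ E / a%:R ^+ E /
  (a + p * j)%:R / p%:R ^+ E =
   (-1 * j%:R) ^+ E * (a%:R^-1) ^+ E * (a + p * j)%:R^-1 :> rat.
  by rewrite exprVn; field; rewrite -natrM -natrD aj0 !expf_neq0.
apply: pintM => //; last exact: pint_inv.
apply: pintM => //; last by apply: pintX => //; apply: pint_inv.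
by apply: pintX => //; apply: pintM;
  [|apply: (pint_int (-1) pr)|apply: pint_nat].
Qed.

(** Exact and truncated factors are integral and congruent, and such congruences multiply because q1
    q3 - q2 q4 = q1 (q3 - q4) + q4 (q1 - q2). *)
Lemma scaled_pint_Wprod_diff p r E N : prime p ->
  scaled_pint p r E (Wprod p (inv_ap p) N - Wprod p (trunc_inv p E) N).
Proof.
move=> pr.
have int_inv a j : (0 < a < p)%N -> pint p (inv_ap p a j).
  move=> /andP[a0 ltap]; apply: pint_inv.
  by rewrite dvdn_addl ?dvdn_mulr // gtnNdvd.
have int_trunc a j : (0 < a < p)%N -> pint p (trunc_inv p E a j).
  move=> /andP[a0 ltap]; have pa : ~~ (p %| a)%N by rewrite gtnNdvd.
  apply: pint_sum => // b; rewrite -exprVn; apply: pintM => //;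
    last by apply/pintX/pint_inv.
  apply: pintM => //; last by apply/pintX/pint_nat.
  by apply: pintX => //; apply: pintM;
    [|apply: (pint_int (-1) pr)|apply: pint_nat].
have int_lin c : pint p c -> scaled_pint p r 0 (1 + c *: 'X).
  move=> ic; apply: scaled_pintD => //; first exact: scaled_pint1.
  apply: scaled_pintZX => //; rewrite expr0 divr1; apply: pintM => //.
  by apply/pintX/pint_nat.
pose good q1 q2 := [/\ scaled_pint p r 0 q1,
  scaled_pint p r 0 q2 & scaled_pint p r E (q1 - q2)].
suff [] : good (Wprod p (inv_ap p) N) (Wprod p (trunc_inv p E) N) by [].
have good1 : good 1 1 by split; rewrite ?subrr;
  [apply: scaled_pint1|apply: scaled_pint1|apply: scaled_pint0].
have goodM q1 q2 q3 q4 : good q1 q2 -> good q3 q4 -> good (q1 * q3) (q2 * q4).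
  move=> [i1 i2 d1] [i3 i4 d2]; split; try exact: scaled_pintM.
  have -> : q1 * q3 - q2 * q4 = q1 * (q3 - q4) + q4 * (q1 - q2) by ring.
  by apply: scaled_pintD => //; apply: scaled_pintM.
rewrite /Wprod; apply: (big_ind2 good) => // j _;
  apply: (big_ind2 good) => // a _.
have a_lt : (0 < a.+1 < p)%N by have := ltn_ord a; have := prime_gt0 pr; lia.
split; [exact/int_lin/int_inv | exact/int_lin/int_trunc |].
have -> : 1 + inv_ap p a.+1 j *: 'X - (1 + trunc_inv p E a.+1 j *: 'X) =
    (inv_ap p a.+1 j - trunc_inv p E a.+1 j) *: 'X by rewrite scalerBl; ring.
apply: scaled_pintZX => //; rewrite -mulrA; apply: pintM => //;
  first by apply/pintX/pint_nat.
exact: inv_trunc_diff.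
Qed.

(** In the k-th coefficient the scaling of t by p ^ (r + 1) costs a factor p ^ (k (r + 1)). The
    order of truncation exceeds n by exactly this exponent. *)
Lemma Csum_trunc r k n p : prime p ->
  rat_congr (p ^ n) (Csum r.+1 k p)
    (k`!%:R * (Wsum p (p ^ r) (Wprod p (trunc_inv p (n + k * r.+1))))`_k).
Proof.
move=> pr; apply: pint_dvd => //; rewrite Csum_Wsum // -mulrBr -coefB.
set E := (n + k * r.+1)%N.
have H : scaled_pint p r.+1 E
  (Wsum p (p ^ r) (Wprod p (inv_ap p)) - Wsum p (p ^ r)
  (Wprod p (trunc_inv p E))).
  rewrite /Wsum -sumrB; apply: scaled_pint_sum => // N; rewrite -mulrBr;
    apply: scaled_pintM => //.
    apply: scaled_pintM => //.
      by have := @scaled_pint_rising p r N false pr; rewrite expr0 scale1r;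
        apply; rewrite -ltnS.
    have := @scaled_pint_rising p r (p ^ r - N) true pr;
      rewrite expr1 scaleN1r; apply.
    exact: leq_subr.
  exact: scaled_pint_Wprod_diff.
have p0 : p%:R != 0 :> rat by rewrite pnatr_eq0 -lt0n prime_gt0.
have := H k; set x := _`_k; rewrite -mulrA;
  rewrite -exprM [(r.+1 * k)%N]mulnC /E exprD.
have -> : p%:R ^+ (k * r.+1) * (x / (p%:R ^+ n * p%:R ^+ (k * r.+1))) =
  x / p%:R ^+ n.
  by field; rewrite !expf_neq0.
by move=> ix; rewrite -mulrA; apply: pintM => //; apply: pint_nat.
Qed.

Lemma Csum_newton r k n p : prime p -> (0 < n)%N ->
  rat_congr (p ^ n) (Csum r.+1 k p)
    (k`!%:R * (\sum_(c < k * (n + k * r.+1)) 'C((p ^ r).-1, c)%:R * rising c.+1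
      (uX p) *
       newton_delta c.+1 (Wprod p (trunc_inv p (n + k * r.+1))))`_k).
Proof.
move=> pr n0; rewrite -Wsum_newton; first exact: Csum_trunc.
  by rewrite expn_gt0 prime_gt0.
(* With n > 0 the order E is a successor: E terms give degree E - 1 in j, hence degree at most m E
   for the m-th coefficient of W_N. *)
case: n n0 => // n _; rewrite addSn => m lem.
apply: (fdeg_leq _ (fdeg_Wprod p m _)) => [|a]; last exact: fdeg_trunc_inv.
by rewrite leq_mul2r lem orbT.
Qed.

(** * Multiple harmonic sums and words *)

Definition fcons (T : Type) (l : nat) (y : T * {ffun 'I_l -> T}) :
  {ffun 'I_l.+1 -> T} :=
  [ffun i => oapp y.2 y.1 (unlift ord0 i)].

Lemma fcons0 T l (y : T * {ffun 'I_l -> T}) : fcons y ord0 = y.1.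
Proof. by rewrite ffunE unlift_none. Qed.

Lemma fconsS T l (y : T * {ffun 'I_l -> T}) j : fcons y (lift ord0 j) = y.2 j.
Proof. by rewrite ffunE liftK. Qed.

Lemma fcons_bij (T : Type) l : bijective (@fcons T l).
Proof.
exists (fun n : {ffun 'I_l.+1 -> T} => (n ord0, [ffun j => n (lift ord0 j)]))
  => [[a f]|n].
  by rewrite fcons0; congr pair; apply/ffunP => j; rewrite ffunE fconsS.
by apply/ffunP => i; case: (unliftP ord0 i) => [j|] ->;
  rewrite ?fconsS ?fcons0 ?ffunE.
Qed.

(** M bounds the index type and N the indices themselves: removing the first index lowers N while
    the type of the functions keeps its bound. *)
Definition mhs_below (M N : nat) (s : seq nat) : rat :=
  \sum_(n : {ffun 'I_(size s) -> 'I_M.+1}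
         | [forall i, (0 < n i <= N)%N]
           && [forall i : 'I_(size s), forall j : 'I_(size s),
                 (i < j)%N ==> (n j < n i)%N])
     \prod_(i < size s) ((n i)%:R ^+ nth 0%N s i)^-1.

Lemma mhs_mhs_below N s : mhs N s = mhs_below N N s.
Proof.
apply: eq_bigl => n; congr (_ && _); apply: eq_forallb => i.
by rewrite -[(n i <= N)%N]ltnS ltn_ord andbT.
Qed.

Lemma mhs_below_cons M N x s : mhs_below M N (x :: s) =
  \sum_(a < M.+1 | (0 < a <= N)%N) (a%:R ^+ x)^-1 * mhs_below M a.-1 s.
Proof.
under [RHS]eq_bigr => a _ do rewrite mulr_sumr.
rewrite pair_big_dep /= {1}/mhs_below (reindex (@fcons 'I_M.+1 (size s))) /=;
  last first.
  by apply: onW_bij; apply: fcons_bij.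
apply: eq_big => [[a f]|[a f] _] /=.
  apply/andP/and3P => [[/forallP pos /forallP dec]|[/andP[a0 aN] /forallP pos
    /forallP dec]].
    split.
    - by have := pos ord0; rewrite fcons0.
    - apply/forallP => j; have /andP[fj _] := pos (lift ord0 j); move: fj.
      rewrite fconsS /= => fj; rewrite fj /=.
      have /forallP/(_ (lift ord0 j)) := dec ord0; rewrite fcons0 fconsS /=.
      by case: (val a) => // a'; rewrite ltnS.
    - apply/forallP => i; apply/forallP => j; apply/implyP => ltij.
      have /forallP/(_ (lift ord0 j)) := dec (lift ord0 i); rewrite !fconsS /=.
      by rewrite /bump /= !add1n ltnS ltij.
  split.
    apply/forallP => i; case: (unliftP ord0 i) => [j|] ->;
      rewrite ?fconsS ?fcons0 /= ?a0 //.
    have /andP[-> /=] := pos j; move=> h; apply: leq_trans h _.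
    by apply: leq_trans (leq_pred _) aN.
  apply/forallP => i; apply/forallP => j; apply/implyP.
  case: (unliftP ord0 i) => [i'|] ->; case: (unliftP ord0 j) => [j'|] ->;
    rewrite ?fconsS ?fcons0 //=.
    rewrite /bump /= !add1n ltnS => lt'.
    by have /forallP/(_ j')/implyP := dec i'; apply.
  by have /andP[_] := pos j'; rewrite -ltnS prednK.
rewrite big_ord_recl fcons0 /=; congr (_ * _); apply: eq_bigr => i _.
by rewrite fconsS.
Qed.

Fixpoint mhs_rec (s : seq nat) (N : nat) : rat :=
  if s is x :: s' then \sum_(a < N) (a.+1%:R ^+ x)^-1 * mhs_rec s' a else 1.

Lemma mhs_below_rec M N s : (N <= M)%N -> mhs_below M N s = mhs_rec s N.
Proof.
elim: s N => [|x s IH] N leN.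
  rewrite /mhs_below (big_pred1 [ffun i : 'I_(size (Nil nat)) => ord0])
    ?big_ord0 // => n.
  rewrite -[RHS]/(n == _); have -> : n == [ffun i => ord0]
    by apply/eqP/ffunP => -[].
  by apply/andP; split; apply/forallP => -[].
rewrite mhs_below_cons -(big_mkord (fun a => 0 < a <= N)%N
  (fun a => (a%:R ^+ x)^-1 * mhs_below M a.-1 s)) big_mkcond big_nat_recl //=
    add0r.
rewrite (big_cat_nat (n := N)) //=
  [X in _ + X]big_nat_cond [X in _ + X]big1 ?addr0; last first.
  by move=> a /andP[/andP[leNa _] _]; rewrite ltnNge leNa.
rewrite big_mkord; apply: eq_bigr => a _; rewrite ltn_ord IH //.
by apply: leq_trans leN; apply: ltnW.
Qed.

Lemma mhsE N s : mhs N s = mhs_rec s N.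
Proof. by rewrite mhs_mhs_below mhs_below_rec. Qed.

Lemma mhs_nil N : mhs N [::] = 1.
Proof. by rewrite mhsE. Qed.

Lemma mhs0_cons x s : mhs 0 (x :: s) = 0.
Proof. by rewrite mhsE /= big_ord0. Qed.

Lemma mhsS_cons N x s : mhs N.+1 (x :: s) =
  mhs N (x :: s) + (N.+1%:R ^+ x)^-1 * mhs N s.
Proof. by rewrite !mhsE /= big_ord_recr. Qed.

(** * Evaluation of lists of monomials at p *)

Section Evaluation.
Variable p : nat.
Hypothesis p_gt0 : (0 < p)%N.

Let p_neq0 : p%:R != 0 :> rat.
Proof. by rewrite pnatr_eq0 -lt0n. Qed.

Definition mono_lin (m : mono) : {poly rat} :=
  (term_coef (mono_term m) * p%:R ^ term_expo (mono_term m)) *: 'X^(mono_deg m).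

Definition lin_val (L : seq mono) : {poly rat} := \sum_(m <- L) mono_lin m.

Definition mono_comp (m : mono) : seq nat := term_comp (mono_term m).

Definition lin_mhs (N : nat) (L : seq mono) : {poly rat} :=
  \sum_(m <- L) mhs N (mono_comp m) *: mono_lin m.

Lemma mono_linM x y : mono_lin (mono_mul x y) = mono_lin x * mono_lin y.
Proof.
rewrite /mono_lin /= exprD expfzDr // -scalerAl -scalerAr scalerA;
  congr (_ *: _).
by rewrite /term_coef /term_expo /=; ring.
Qed.

Lemma mono_compM x y : mono_comp (mono_mul x y) = mono_comp x ++ mono_comp y.
Proof. by []. Qed.

Lemma mono_lin1 : mono_lin mono1 = 1.
Proof. by rewrite /mono_lin /= expr0z mulr1 scale1r. Qed.

Lemma sum_lmul (V : nmodType) (F : mono -> V) s t :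
  \sum_(m <- lmul s t) F m = \sum_(x <- s) \sum_(y <- t) F (mono_mul x y).
Proof. by rewrite /lmul big_flatten big_map; apply: eq_bigr => x _;
  rewrite big_map. Qed.

Lemma lin_val_lmul s t : lin_val (lmul s t) = lin_val s * lin_val t.
Proof.
rewrite /lin_val sum_lmul mulr_suml; apply: eq_bigr => x _; rewrite mulr_sumr.
by apply: eq_bigr => y _; rewrite mono_linM.
Qed.

(** With empty compositions on the left, concatenation leaves those on the right alone, and the left
    list acts as a scalar. *)
Lemma lin_mhs_lmul N s t : all (fun m => mono_comp m == [::]) s ->
  lin_mhs N (lmul s t) = lin_val s * lin_mhs N t.
Proof.
move=> s0; rewrite /lin_mhs sum_lmul /lin_val mulr_suml;
  apply: eq_big_seq => x xs.
rewrite mulr_sumr; apply: eq_bigr => y _; rewrite mono_linM.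
have /eqP x0 := allP s0 x xs; rewrite mono_compM x0 /=.
by rewrite -[RHS]scalerAr.
Qed.

Lemma all_lmul (Q : pred mono) s t :
  (forall x y, Q x -> Q y -> Q (mono_mul x y)) ->
  all Q s -> all Q t -> all Q (lmul s t).
Proof.
move=> QM /allP Qs /allP Qt;
  apply/allP => m /flattenP[l /mapP[x xs ->] /mapP[y yt ->]].
by apply: QM; [apply: Qs|apply: Qt].
Qed.

Lemma all_lprod (Q : pred mono) S :
  (forall x y, Q x -> Q y -> Q (mono_mul x y)) -> Q mono1 ->
  all (all Q) S -> all Q (lprod S).
Proof.
move=> QM Q1; elim: S => [|s S IH] /=; first by rewrite Q1.
by case/andP => Qs /IH; apply: all_lmul.
Qed.

Lemma lin_val_lprod I (s : seq I) (F : I -> seq mono) :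
  lin_val (lprod [seq F i | i <- s]) = \prod_(i <- s) lin_val (F i).
Proof.
elim: s => [|i s IH]; first by rewrite big_nil /lin_val /= big_seq1 mono_lin1.
by rewrite big_cons -IH -lin_val_lmul.
Qed.

Lemma big_iota0 (V : nmodType) n (F : nat -> V) :
  \sum_(i <- iota 0 n) F i = \sum_(i < n) F i.
Proof. by rewrite -[n in iota _ n]subn0 big_mkord. Qed.

Lemma prod_iota0 n (F : nat -> {poly rat}) :
  \prod_(i <- iota 0 n) F i = \prod_(i < n) F i.
Proof. by rewrite -[n in iota _ n]subn0 big_mkord. Qed.

Definition letter_sum (L : seq mono) (a : nat) : {poly rat} :=
  \sum_(m <- L) (a%:R ^+ head 0%N (mono_comp m))^-1 *: mono_lin m.

Definition words (L : seq mono) (l : nat) : seq mono :=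
  lprod [seq L | _ <- iota 0 l].

Lemma wordsS L l : words L l.+1 = lmul L (words L l).
Proof. by rewrite /words /= -[1%N]addn0 iotaDl -map_comp. Qed.

Lemma lin_mhs_words0 L N : lin_mhs N (words L 0) = 1.
Proof. by rewrite /words /= /lin_mhs big_seq1 mono_lin1 /mono_comp /=
  mhs_nil scale1r. Qed.

Lemma lin_mhs_wordsS0 L l : all (fun m => size (mono_comp m) == 1%N) L ->
  lin_mhs 0 (words L l.+1) = 0.
Proof.
move=> L1; rewrite wordsS /lin_mhs sum_lmul big_seq big1 // => x xL.
rewrite big1 // => y _; have := allP L1 x xL.
rewrite mono_compM.
by case: (mono_comp x) => [|s []] //= _; rewrite mhs0_cons scale0r.
Qed.

(** Either no index equals N + 1, or the first letter takes it and the remaining letters have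
    indices up to N. *)
Lemma lin_mhs_wordsS L l N : all (fun m => size (mono_comp m) == 1%N) L ->
  lin_mhs N.+1 (words L l.+1) =
  lin_mhs N (words L l.+1) + letter_sum L N.+1 * lin_mhs N (words L l).
Proof.
move=> L1; rewrite wordsS /lin_mhs !sum_lmul /letter_sum mulr_suml -big_split.
apply: eq_big_seq => x xL; rewrite mulr_sumr -big_split; apply: eq_bigr => y _.
have := allP L1 x xL; rewrite mono_linM !mono_compM.
case: (mono_comp x) => [|s []] //= _; rewrite mhsS_cons scalerDl; congr (_ + _).
by move: (mono_lin x) (mono_lin y) => q1 q2;
  rewrite -scalerAl -scalerAr scalerA.
Qed.

(* Only words of length at most k contribute to the coefficient of X ^ k, as
   every letter is divisible by X. *)
Lemma coef_words L N K k : all (fun m => size (mono_comp m) == 1%N) L ->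
  (forall a, (letter_sum L a)`_0 = 0) -> (k <= K)%N ->
  (\prod_(a < N) (1 + letter_sum L a.+1))`_k =
  (\sum_(l < K.+1) lin_mhs N (words L l))`_k.
Proof.
move=> L1 L0; elim: N K k => [|N IH] K k lek.
  rewrite big_ord0 big_ord_recl lin_mhs_words0 big1 ?addr0 // => l _.
  by rewrite lin_mhs_wordsS0.
rewrite big_ord_recr /= mulrDr mulr1 coefD (IH K k lek).
rewrite ![\sum_(l < K.+1) _]big_ord_recl !lin_mhs_words0 /=.
have -> : \sum_(l < K) lin_mhs N.+1 (words L (bump 0 l)) =
    \sum_(l < K) lin_mhs N (words L (bump 0 l)) +
    letter_sum L N.+1 * \sum_(l < K) lin_mhs N (words L l).
  rewrite mulr_sumr -big_split; apply: eq_bigr => l _.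
  by rewrite /bump /= add1n lin_mhs_wordsS.
rewrite addrA [in RHS]coefD; congr (_ + _).
(* The letter sum has no constant term, so the other factor enters only through coefficients below
   k, for which words of length below K suffice. *)
rewrite mulrC !coefM; apply: eq_bigr => -[[|j] ltj] _ /=;
  first by rewrite L0 !mul0r.
congr (_ * _); case: K lek => [|K] lek; first by lia.
by rewrite (IH K) //; lia.
Qed.

Lemma mono_lin_coef m i : (mono_lin m)`_i =
  if mono_deg m == i then term_coef (mono_term m) * p%:R ^ term_expo
    (mono_term m) else 0.
Proof. by rewrite coefZ coefXn eq_sym; case: eqP; rewrite ?mulr1 ?mulr0. Qed.
End Evaluation.

(** Supplies the power of 1 / a that [lfactor] leaves implicit. It is multiplicative on nonnegative
    exponents, where the absolute value is additive. *)
Definition letter_weight (p a : nat) (m : mono) : {poly rat} :=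
  (a%:R ^+ (mono_deg m + `|term_expo (mono_term m)|))^-1 *: mono_lin p m.

Definition nonneg_expo (m : mono) : bool := 0 <= term_expo (mono_term m).

Lemma nonneg_expoM x y : nonneg_expo x -> nonneg_expo y ->
  nonneg_expo (mono_mul x y).
Proof. exact: addr_ge0. Qed.

Lemma letter_weightM p a x y : (0 < p)%N -> nonneg_expo x -> nonneg_expo y ->
  letter_weight p a (mono_mul x y) = letter_weight p a x * letter_weight p a y.
Proof.
move=> p0 x0 y0; rewrite /letter_weight mono_linM //.
move: (mono_lin p x) (mono_lin p y) => q1 q2;
  rewrite -scalerAl -scalerAr scalerA -invfM -exprD.
congr ((_ ^+ _)^-1 *: _) => /=; move: x0 y0;
  rewrite /nonneg_expo /mono_deg /mono_term /term_expo /=.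
by case: x y => [dx [cx ex]] [dy [cy ey]] /=; lia.
Qed.

Lemma sum_letter_weight_lprod (I : eqType) p a (s : seq I)
  (F : I -> seq mono) : (0 < p)%N ->
  (forall i, all nonneg_expo (F i)) ->
  \sum_(m <- lprod [seq F i | i <- s]) letter_weight p a m =
  \prod_(i <- s) \sum_(m <- F i) letter_weight p a m.
Proof.
move=> p0 F0; elim: s => [|i s IH].
  by rewrite big_nil /= big_seq1 /letter_weight mono_lin1 /=
    expr0 invr1 scale1r.
rewrite big_cons -IH /= sum_lmul mulr_suml; apply: eq_big_seq => x xF.
rewrite mulr_sumr; apply: eq_big_seq => y yF; apply: letter_weightM => //.
  exact: (allP (F0 i)).
have : all nonneg_expo (lprod [seq F i | i <- s]).
  apply: all_lprod => //; first exact: nonneg_expoM.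
  by apply/allP => l /mapP[j _ ->].
by move/allP; apply.
Qed.

Lemma nonneg_lfactor E j : all nonneg_expo (lfactor E j).
Proof. by apply/allP => m; rewrite inE => /predU1P[->|/mapP[b _ ->]]. Qed.

Lemma sum_lfactor p a E j :
  \sum_(m <- lfactor E j) letter_weight p a m = 1 + trunc_inv p E a j *: 'X.
Proof.
rewrite /lfactor big_cons /letter_weight mono_lin1 /= expr0 invr1 scale1r;
  congr (_ + _).
rewrite big_map big_iota0 /trunc_inv scaler_suml; apply: eq_bigr => b _.
rewrite /mono_lin /mono_deg /mono_term /term_coef /term_expo /= scalerA expr1;
  congr (_ *: _).
by rewrite add1n mulrC exprnP.
Qed.

Lemma size_letters E i : all (fun m => size (mono_comp m) == 1%N) (letters E i).
Proof. by apply/allP => m /mapP[m' _ ->]. Qed.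

Lemma letter_sum_letters p E i a : (0 < p)%N ->
  1 + letter_sum p (letters E i) a =
    \prod_(j < i) (1 + trunc_inv p E a j *: 'X).
Proof.
move=> p0.
have -> : letter_sum p (letters E i) a =
    \sum_(m <- lprod [seq lfactor E j | j <- iota 0 i] | (0 < mono_deg m)%N)
      letter_weight p a m.
  by rewrite /letter_sum /letters big_map big_filter.
set L := lprod _.
have total : \sum_(m <- L) letter_weight p a m =
  \prod_(j < i) (1 + trunc_inv p E a j *: 'X).
  rewrite sum_letter_weight_lprod //; last exact: nonneg_lfactor.
  by rewrite prod_iota0; apply: eq_bigr => j _; rewrite sum_lfactor.
rewrite -total [RHS](bigID (fun m => 0 < mono_deg m)%N) /= addrC; congr (_ + _).
apply/esym.
(* The monomials of degree 0 sum to the constant coefficient of the total. *)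
have wE m j : mono_deg m != j -> (letter_weight p a m)`_j = 0.
  by move=> mj; rewrite coefZ mono_lin_coef (negPf mj) mulr0.
apply/polyP => k; rewrite coef1.
have [->|k0] := eqVneq k 0%N.
  have := congr1 (fun q : {poly rat} => q`_0) total.
  rewrite coef0_lin_prod coef_sum (bigID (fun m => 0 < mono_deg m)%N) /=
    big1 ?add0r.
    by rewrite coef_sum => ->.
  by move=> m m0; rewrite wE // -lt0n.
rewrite coef_sum big1 // => m; rewrite -eqn0Ngt => /eqP m0.
by rewrite wE // m0 eq_sym.
Qed.

Lemma letter_sum_coef0 p E i a : (letter_sum p (letters E i) a)`_0 = 0.
Proof.
rewrite /letter_sum coef_sum /letters big_map big_filter big1 // => m m0.
by rewrite coefZ mono_lin_coef gtn_eqF ?mulr0.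
Qed.

(** With the product over a outermost, every a contributes 1 plus the sum of the same letters
    weighted at a. Expanding chooses distinct indices a below p, each with a letter, which is what
    the sums H_{p-1} of words collect. *)
Lemma coef_Wprod_words p E i k m : (0 < p)%N -> (m <= k)%N ->
  (Wprod p (trunc_inv p E) i)`_m =
  (\sum_(l < k.+1) lin_mhs p p.-1 (words (letters E i) l))`_m.
Proof.
move=> p0 lem; rewrite -(coef_words p0 p.-1 (size_letters E i)
  (letter_sum_coef0 p E i) lem).
rewrite /Wprod exchange_big /=; congr (_`_m); congr polyseq;
  apply: eq_bigr => a _.
by rewrite letter_sum_letters.
Qed.

(** * Evaluation of the blocks *)

Lemma lin_val_Pfactors p r c : (0 < p)%N ->
  lin_val p (lprod [seq Pfactor r.+1 q | q <- iota 0 c]) =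
    (c`! * 'C((p ^ r).-1, c))%:R.
Proof.
move=> p0; rewrite lin_val_lprod // prod_iota0 mulnC bin_ffact.
have PE q : lin_val p (Pfactor r.+1 q) = ((p ^ r)%:R - q.+1%:R : rat)%:P.
  rewrite /lin_val /Pfactor big_cons big_seq1 /mono_lin /=
    !expr0 !alg_polyC -polyCD; congr (_%:P).
  by rewrite /term_coef /term_expo /= expr0z mulr1 mul1r mulN1r natrX -exprnP.
have P0 : (0 < p ^ r)%N by rewrite expn_gt0 p0.
elim: c => [|c IH]; first by rewrite big_ord0 ffactn0.
rewrite big_ord_recr /= IH PE ffactnSr natrM.
(* Past P - 1 the falling factorial already vanishes; before that the natural subtraction P - 1 - c
   is exact. *)
have [ltc|lec] := ltnP (p ^ r).-1 c; first by rewrite ffact_small // !mul0r.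
congr (_ * _); rewrite -polyC_natr; congr (_%:P).
by rewrite natrB // -[in LHS](prednK P0) -!natr1; ring.
Qed.

Lemma lin_val_ufactors p c : (0 < p)%N ->
  lin_val p (lprod [seq ufactor q | q <- iota 0 c]) = c`!%:R *: rising c (uX p).
Proof.
move=> p0; rewrite lin_val_lprod // prod_iota0 /rising scalerA mulfV ?scale1r;
  last first.
  by rewrite pnatr_eq0 -lt0n fact_gt0.
apply: eq_bigr => q _; rewrite /lin_val /ufactor big_cons big_seq1 /mono_lin /=
  expr0 expr1.
rewrite /term_coef /term_expo /= expr0z mulr1 mul1r alg_polyC polyC_natr.
by rewrite /uX -exprN1.
Qed.

Lemma lin_mhs_block p r k E c i l : (0 < p)%N ->
  lin_mhs p p.-1 (block r.+1 k E c i l) =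
  newton_coef k c i *: ((c`! * 'C((p ^ r).-1, c))%:R *
    (c.+1`!%:R *: rising c.+1 (uX p)) * lin_mhs p p.-1 (words (letters E i) l)).
Proof.
move=> p0; have nilM x y : mono_comp x == [::] -> mono_comp y == [::] ->
    mono_comp (mono_mul x y) == [::].
  by move=> /eqP x0 /eqP y0; rewrite mono_compM x0 y0.
rewrite /block !lin_mhs_lmul //.
- rewrite lin_val_Pfactors // lin_val_ufactors // {1}/lin_val big_seq1
  /mono_lin /=.
  rewrite /term_coef /term_expo /= expr0z mulr1 expr0 -mulrA -/(words _ _).
  by rewrite -scalerAl mul1r.
- by apply: all_lprod => //; apply/allP => s /mapP[q _ ->].
- by apply: all_lprod => //; apply/allP => s /mapP[q _ ->].
Qed.

Lemma newton_coefE k c i : (i <= c.+1)%N ->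
  newton_coef k c i * c`!%:R * c.+1`!%:R =
    k`!%:R * ((-1) ^+ (c.+1 - i) * 'C(c.+1, i)%:R).
Proof.
move=> lei; rewrite /newton_coef -(bin_fact lei) !natrM.
have f0 n : n`!%:R != 0 :> rat by rewrite pnatr_eq0 -lt0n fact_gt0.
by field; rewrite !f0.
Qed.

(** An equality, as the only approximation is the truncation of the inverses. Filtering by degree k
    extracts the coefficient of t ^ k. *)
Lemma eval_Fterms p r k n : (0 < p)%N ->
  eval_terms p (Fterms r.+1 k n) =
  k`!%:R * (\sum_(c < k * (n + k * r.+1)) 'C((p ^ r).-1, c)%:R * rising c.+1
    (uX p) *
       newton_delta c.+1 (Wprod p (trunc_inv p (n + k * r.+1))))`_k.
Proof.
move=> p0; set E := (n + k * r.+1)%N.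
transitivity (lin_mhs p p.-1 (blocks r.+1 k E))`_k.
  rewrite /eval_terms /Fterms big_map big_filter /lin_mhs coef_sum
    [LHS]big_mkcond.
  apply: eq_bigr => m _; rewrite coefZ mono_lin_coef; case: eqP => _;
    rewrite ?mulr0 //.
  by rewrite mulrC.
have -> : lin_mhs p p.-1 (blocks r.+1 k E) =
  \sum_(c < k * E) \sum_(i < c.+2) \sum_(l < k.+1)
    lin_mhs p p.-1 (block r.+1 k E c i l).
  rewrite {1}/lin_mhs /blocks big_flatten big_map big_iota0;
    apply: eq_bigr => c _.
  rewrite big_flatten big_map big_iota0; apply: eq_bigr => i _.
  by rewrite big_flatten big_map big_iota0.
rewrite !coef_sum mulr_sumr; apply: eq_bigr => c _.
rewrite /newton_delta mulr_sumr !coef_sum mulr_sumr; apply: eq_bigr => i _.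
under eq_bigr => l _ do rewrite lin_mhs_block //.
rewrite -scaler_sumr -mulr_sumr coefZ.
set w := \sum_(l < _) _; set W := Wprod _ _ _; set x := (-1) ^+ _ * _.
(* The words up to length k reproduce W_i only up to degree k, which is all that this coefficient
   sees. *)
have wE q : (q * w)`_k = (q * W)`_k.
  rewrite !coefM; apply: eq_bigr => j _; congr (_ * _).
  by rewrite (@coef_Wprod_words p E i k) // leq_subr.
rewrite wE {wE}; move: W (rising _ _) => W R; set b := 'C((p ^ r).-1, c).
have -> : (c`! * b)%:R * (c.+1`!%:R *: R) * W = (c`!%:R * b%:R * c.+1`!%:R) *:
  (R * W).
  by rewrite -!mul_polyC !polyCM !polyC_natr natrM; ring.
have -> : b%:R * R * (x *: W) = (b%:R * x) *: (R * W).
  by rewrite -!mul_polyC !polyCM !polyC_natr; ring.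
have : newton_coef k c i * c`!%:R * c.+1`!%:R = k`!%:R * x by apply:
  newton_coefE; rewrite -ltnS.
rewrite !coefZ; move: x => x xE.
have -> : k`!%:R * (b%:R * x * (R * W)`_k) = (k`!%:R * x) * (b%:R * (R * W)`_k)
  by ring.
rewrite -xE.
by ring.
Qed.

(** Every entry is a letter's degree plus the absolute value of its exponent, and the degree is
    positive by the filter in [letters]. *)
Lemma Fterms_composition r k n t : t \in Fterms r k n ->
  is_composition (term_comp t).
Proof.
suff : all (fun m => is_composition (mono_comp m)) (blocks r k (n + k * r)).
  by move=> /allP H /mapP[m]; rewrite mem_filter => /andP[_ mb] ->; apply: H.
have compM x y : is_composition (mono_comp x) -> is_composition (mono_comp y) ->
    is_composition (mono_comp (mono_mul x y)).
  by rewrite mono_compM /is_composition all_cat => -> ->.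
apply/allP => m /flattenP[s /mapP[c _ ->]] /flattenP[s' /mapP[i _ ->]].
move=> /flattenP[s'' /mapP[l _ ->]]; move: m; apply/allP.
rewrite /block; do 3?[apply: all_lmul => //].
- by apply: all_lprod => //; apply/allP => L /mapP[q _ ->].
- by apply: all_lprod => //; apply/allP => L /mapP[q _ ->].
- apply: all_lprod => //; apply/allP => L /mapP[q _ ->].
  apply/allP => m /mapP[m']; rewrite mem_filter => /andP[m0 _] ->.
  by rewrite /is_composition /mono_comp /= andbT ltn_addr.
Qed.

Local Close Scope ring_scope.

Theorem theorem2 :
  exists F : nat -> nat -> nat -> seq mhs_term,
    computable (fun x : nat * nat * nat => F x.1.1 x.1.2 x.2) /\
    forall r k n : nat, 0 < r -> 0 < k -> 0 < n ->
      (forall t, t \in F r k n -> is_composition (term_comp t)) /\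
      exists p0 : nat, forall p : nat, prime p -> p0 <= p ->
        rat_congr (p ^ n) (Csum r k p) (eval_terms p (F r k n)).
Proof.
exists Fterms; split; first exact: computable_Fterms.
move=> [//|r] k n _ _ n0; split; first exact: Fterms_composition.
(* The estimates hold at every prime, so the threshold can be 0. *)
exists 0 => p pr _; rewrite eval_Fterms ?prime_gt0 //.
exact: Csum_newton.
Qed.
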